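(* If for all sets $A$ and $B$ which both have the strong Myhill property the set $A^B$ of functions $B \to A$ has the Myhill property, then excluded middle holds (i.e. $p \vee \neg p$ for every $p \in \Omega$).
   Context: The statement is to be proved constructively (intuitionistic set theory with powersets and $\mathbb{N}$, equivalently the internal logic of a topos with natural numbers object; neither excluded middle nor choice is assumed). $\Omega = \mathcal{P}(1)$ is the set of truth values. A set $X$ has the Myhill property if for all subsets $A, B \subseteq X$: if there are injections $f, g : X \to X$ with $A = f^{-1}(B)$ and $B = g^{-1}(A)$, then there is a bijection $h : X \to X$ which restricts to a bijection between $A$ and $B$. For injections $f, g : X \to X$ and $m \in \mathbb{Z}$, let $R^{f,g}_m \subseteq X \times X$ be the partial injection $f \circ (g \circ f)^m$: for $m \ge 0$, $(x,y) \in R^{f,g}_m$ iff $y = f((g\circ f)^m(x))$; for $m < 0$, $(x,y) \in R^{f,g}_m$ iff $x = g((f \circ g)^{-m-1}(y))$. A set $X$ has the strong Myhill property if for every pair of injections $f, g : X \to X$ there is a bijection $h : X \to X$ whose graph is contained in $\bigcup_{m \in \mathbb{Z}} R^{f,g}_m$. *)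

(* Defs.v *)
(* Excluded middle is admissible as an axiom in Rocq, so a theorem "... -> forall
   p : Prop, p \/ ~ p" would say nothing about constructive provability.  The
   constructive background theory is therefore made explicit: intuitionistic
   first-order logic with equality over the language of set theory, and in it
   intuitionistic set theory with power sets and the natural numbers.
   Separation is restricted to bounded formulas, which makes this set theory the
   one matching the internal logic of toposes with natural numbers object. *)
From Stdlib Require Import List.
Import ListNotations.

(** * Formulas and intuitionistic natural deduction *)

(* De Bruijn indices; variables are the only terms. *)
Inductive form : Set :=
| Bot : form
| Eq  : nat -> nat -> form
| Mem : nat -> nat -> form
| And : form -> form -> form
| Or  : form -> form -> form
| Imp : form -> form -> form
| All : form -> form
| Ex  : form -> form.

Definition up (r : nat -> nat) (n : nat) : nat :=
  match n with 0 => 0 | S n => S (r n) end.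

Fixpoint ren (r : nat -> nat) (a : form) : form :=
  match a with
  | Bot => Bot
  | Eq x y => Eq (r x) (r y)
  | Mem x y => Mem (r x) (r y)
  | And a b => And (ren r a) (ren r b)
  | Or a b => Or (ren r a) (ren r b)
  | Imp a b => Imp (ren r a) (ren r b)
  | All a => All (ren (up r) a)
  | Ex a => Ex (ren (up r) a)
  end.

Definition shift : form -> form := ren S.

Definition inst (t : nat) : form -> form :=
  ren (fun n => match n with 0 => t | S n => n end).

(* [T] is a set of axioms; their free variables, if any, are read universally. *)
Inductive prv (T : form -> Prop) : list form -> form -> Prop :=
| prv_ax   G a     : T a -> prv T G a
| prv_hyp  G a     : In a G -> prv T G a
| prv_botE G a     : prv T G Bot -> prv T G a
| prv_andI G a b   : prv T G a -> prv T G b -> prv T G (And a b)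
| prv_andL G a b   : prv T G (And a b) -> prv T G a
| prv_andR G a b   : prv T G (And a b) -> prv T G b
| prv_orL  G a b   : prv T G a -> prv T G (Or a b)
| prv_orR  G a b   : prv T G b -> prv T G (Or a b)
| prv_orE  G a b c : prv T G (Or a b) -> prv T (a :: G) c -> prv T (b :: G) c ->
                     prv T G c
| prv_impI G a b   : prv T (a :: G) b -> prv T G (Imp a b)
| prv_impE G a b   : prv T G (Imp a b) -> prv T G a -> prv T G b
| prv_allI G a     : prv T (map shift G) a -> prv T G (All a)
| prv_allE G a t   : prv T G (All a) -> prv T G (inst t a)
| prv_exI  G a t   : prv T G (inst t a) -> prv T G (Ex a)
| prv_exE  G a b   : prv T G (Ex a) -> prv T (a :: map shift G) (shift b) ->
                     prv T G b
| prv_eqI  G x     : prv T G (Eq x x)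
| prv_eqE  G a x y : prv T G (Eq x y) -> prv T G (inst x a) -> prv T G (inst y a).

(** * Named variables *)

(* To write formulas with binders, an [fm] is a formula in a scope of a given
   number [d] of variables, and a variable is named by its de Bruijn level
   (its position from the outside), so that it keeps its name under binders;
   level [x] in scope [d] is index [d - 1 - x].  The sentence denoted by a
   closed [a : fm] is [a 0]. *)
Definition fm : Type := nat -> form.
Definition var : Set := nat.

Definition index (d : nat) (x : var) : nat := d - S x.

Definition fbot : fm := fun _ => Bot.
Definition feq (x y : var) : fm := fun d => Eq (index d x) (index d y).
Definition fmem (x y : var) : fm := fun d => Mem (index d x) (index d y).
Definition fand (a b : fm) : fm := fun d => And (a d) (b d).
Definition for_ (a b : fm) : fm := fun d => Or (a d) (b d).
Definition fimp (a b : fm) : fm := fun d => Imp (a d) (b d).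
Definition fall (P : var -> fm) : fm := fun d => All (P d (S d)).
Definition fex (P : var -> fm) : fm := fun d => Ex (P d (S d)).

Declare Scope fm_scope.
Delimit Scope fm_scope with fm.
Bind Scope fm_scope with fm.

Notation "x ≐ y" := (feq x y) (at level 70, no associativity) : fm_scope.
Notation "x ∈ y" := (fmem x y) (at level 70, no associativity) : fm_scope.
Notation "a ∧ b" := (fand a b) (at level 80, right associativity) : fm_scope.
Notation "a ∨ b" := (for_ a b) (at level 85, right associativity) : fm_scope.
Notation "a → b" := (fimp a b)
  (at level 99, b at level 200, right associativity) : fm_scope.
Notation "¬ a" := (fimp a fbot) (at level 75, right associativity) : fm_scope.
Notation "a ↔ b" := (fand (fimp a b) (fimp b a))
  (at level 95, no associativity) : fm_scope.
Notation "∀ x .. y , P" := (fall (fun x => .. (fall (fun y => P%fm)) ..))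
  (at level 200, x binder, y binder, right associativity) : fm_scope.
Notation "∃ x .. y , P" := (fex (fun x => .. (fex (fun y => P%fm)) ..))
  (at level 200, x binder, y binder, right associativity) : fm_scope.
(* Bounded quantifiers; all the variables listed range over the set [a]. *)
Notation "∀[ a ] x .. y , P" :=
  (fall (fun x => fimp (fmem x a) ..
    (fall (fun y => fimp (fmem y a) P%fm)) ..))
  (at level 200, a at level 69, x binder, y binder, right associativity) : fm_scope.
Notation "∃[ a ] x .. y , P" :=
  (fex (fun x => fand (fmem x a) ..
    (fex (fun y => fand (fmem y a) P%fm)) ..))
  (at level 200, a at level 69, x binder, y binder, right associativity) : fm_scope.

Local Open Scope fm_scope.

(** * Basic set-theoretic vocabulary *)

Definition subset (a b : var) : fm := ∀[a] x, x ∈ b.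

Definition is_empty (e : var) : fm := ∀[e] x, fbot.

(* z = {x, y} *)
Definition is_upair (z x y : var) : fm :=
  x ∈ z ∧ y ∈ z ∧ ∀[z] w, w ≐ x ∨ w ≐ y.

(* p = (x, y) = {{x}, {x, y}} *)
Definition is_pair (p x y : var) : fm :=
  (∃[p] z, is_upair z x x) ∧ (∃[p] z, is_upair z x y) ∧
  (∀[p] z, is_upair z x x ∨ is_upair z x y).

(* (x, y) ∈ r *)
Definition related (r x y : var) : fm := ∃[r] p, is_pair p x y.

(* m = n ∪ {n} *)
Definition is_succ (m n : var) : fm :=
  n ∈ m ∧ (∀[n] k, k ∈ m) ∧ (∀[m] k, k ∈ n ∨ k ≐ n).

Definition inductive_set (i : var) : fm :=
  (∃[i] z, is_empty z) ∧ (∀[i] n, ∃[i] m, is_succ m n).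

Definition is_nat_set (N : var) : fm :=
  inductive_set N ∧ ∀ i, inductive_set i → subset N i.

(** * The axioms *)

Inductive bounded : form -> Prop :=
| bounded_Bot     : bounded Bot
| bounded_Eq x y  : bounded (Eq x y)
| bounded_Mem x y : bounded (Mem x y)
| bounded_And a b : bounded a -> bounded b -> bounded (And a b)
| bounded_Or a b  : bounded a -> bounded b -> bounded (Or a b)
| bounded_Imp a b : bounded a -> bounded b -> bounded (Imp a b)
| bounded_All y a : bounded a -> bounded (All (Imp (Mem 0 (S y)) a))
| bounded_Ex y a  : bounded a -> bounded (Ex (And (Mem 0 (S y)) a)).

Definition extensionality : fm := ∀ a b, (∀ x, x ∈ a ↔ x ∈ b) → a ≐ b.
Definition pairing : fm := ∀ a b, ∃ c, ∀ x, x ∈ c ↔ x ≐ a ∨ x ≐ b.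
Definition union : fm := ∀ a, ∃ b, ∀ x, x ∈ b ↔ ∃[a] y, x ∈ y.
Definition powerset : fm := ∀ a, ∃ b, ∀ x, x ∈ b ↔ subset x a.
Definition infinity : fm := ∃ N, is_nat_set N.

(* ∀ a, ∃ b, ∀ x, x ∈ b ↔ x ∈ a ∧ P, where in [P] index 0 is x and the other
   indices are parameters: the renaming skips over b and a. *)
Definition separation (P : form) : form :=
  let P' := ren (fun n => match n with 0 => 0 | S n => S (S (S n)) end) P in
  All (Ex (All (And (Imp (Mem 0 1) (And (Mem 0 2) P'))
                    (Imp (And (Mem 0 2) P') (Mem 0 1))))).

Inductive set_theory : form -> Prop :=
| ax_extensionality : set_theory (extensionality 0)
| ax_pairing        : set_theory (pairing 0)
| ax_union          : set_theory (union 0)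
| ax_powerset       : set_theory (powerset 0)
| ax_infinity       : set_theory (infinity 0)
| ax_separation P   : bounded P -> set_theory (separation P).

Definition provable (a : fm) : Prop := prv set_theory [] (a 0).

(** * Functions *)

Definition is_function (f A B : var) : fm :=
  (∀[f] p, ∃[A] x, ∃[B] y, is_pair p x y) ∧
  (∀[A] x, ∃[B] y, related f x y ∧ ∀[B] y', related f x y' → y' ≐ y).

Definition is_injection (f A B : var) : fm :=
  is_function f A B ∧
  ∀[A] x x', ∀[B] y, related f x y → related f x' y → x ≐ x'.

Definition is_bijection (f A B : var) : fm :=
  is_injection f A B ∧ ∀[B] y, ∃[A] x, related f x y.

(* E = A^B *)
Definition is_function_set (E A B : var) : fm :=
  ∀ f, f ∈ E ↔ is_function f B A.

(* A = f^{-1}(B), for f a function on X *)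
Definition is_preimage (A f B X : var) : fm :=
  ∀ x, x ∈ A ↔ x ∈ X ∧ ∃[B] y, related f x y.

(* h restricts to a bijection between A and B *)
Definition restricts_to_bijection (h A B : var) : fm :=
  ∃ k, subset k h ∧ is_bijection k A B.

(* k = g ∘ f, for functions f and g from X to X *)
Definition is_composite (k g f X : var) : fm :=
  is_function k X X ∧
  ∀[X] x y z, related f x y → related g y z → related k x z.

(* y = k^n(x), for k a function from X to X: the value at n of the sequence
   t : N → X with t(0) = x and t(i+1) = k(t(i)) *)
Definition is_iterate (N X k n x y : var) : fm :=
  ∃ t, is_function t N X ∧
    (∀[N] z, is_empty z → related t z x) ∧
    (∀[N] i j, is_succ j i → ∀[X] u v, related t i u → related t j v → related k u v) ∧
    related t n y.

(** * The Myhill properties *)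

Definition myhill (X : var) : fm :=
  ∀ A B, subset A X → subset B X →
  ∀ f g, is_injection f X X → is_injection g X X →
    is_preimage A f B X → is_preimage B g A X →
    ∃ h, is_bijection h X X ∧ restricts_to_bijection h A B.

(* (x, y) ∈ R^{f,g}_n, i.e. y = f((g ∘ f)^n(x)), for a natural number n *)
Definition R_nonneg (N X f g n x y : var) : fm :=
  ∃ k, is_composite k g f X ∧ ∃[X] u, is_iterate N X k n x u ∧ related f u y.

(* (x, y) ∈ R^{f,g}_m for m = -n-1, i.e. x = g((f ∘ g)^n(y)) *)
Definition R_neg (N X f g n x y : var) : fm :=
  ∃ k, is_composite k f g X ∧ ∃[X] u, is_iterate N X k n y u ∧ related g u x.

(* The union over the integers is split into the m = n and the m = -n-1. *)
Definition strong_myhill (N X : var) : fm :=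
  ∀ f g, is_injection f X X → is_injection g X X →
  ∃ h, is_bijection h X X ∧
    ∀[X] x y, related h x y →
      ∃[N] n, R_nonneg N X f g n x y ∨ R_neg N X f g n x y.

(* A truth value is a subset p of 1 = {e}, e the empty set; it holds iff e ∈ p. *)
Definition excluded_middle : fm :=
  ∀ e, is_empty e → ∀ p, (∀[p] x, x ≐ e) → e ∈ p ∨ ¬ e ∈ p.

(* Main.v *)
(* Let Ω = P(1) and let 0 be the everywhere false element of X = Ω^N.  On X consider the injections
   f S = (S 0 → S 1, S 0, S 1, ...) and g S = (true, S 0, S 1, ...), and the subsets
   A = {S | S 0 → S 1} and B = {S | S 0}.  Then A = f^{-1}(B), B = g^{-1}(A) and 0 ∈ A, so the
   Myhill property of X gives a bijection h of X such that b = h 0 satisfies b 0.  Let D be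
   p ∨ ¬p, and let T = h^{-1}(b ∧ D).  If D holds, then b ∧ D = b and T = 0; since ¬¬D holds and
   0 is ¬¬-closed, T = 0, hence b ∧ D = b, and evaluating at 0 gives D.

   Ω has the strong Myhill property because all its self-injections are surjective (Higgs).  For
   N, call a and b matched by a pair of injections (f, g) if f a = b and g b = a.  Composing g with
   the transposition of x and g (f x) makes x and f x matched and keeps everything that was matched
   already, and it does not leave the union of the R^{f,g}_m; only decidable equality on N is used.
   Treating in turn all elements of both copies of N, the matched pairs grow to a bijection.

   The formal derivation is obtained through a model: a proposition is a monotone, local predicate
   on contexts, and the eigenvariable rules take the form of quantification over all variables, so
   that a formula is provable as soon as its interpretation holds in the empty context. *)
From Stdlib Require Import List Arith Lia.
Require Import Defs.
Import ListNotations.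

(** * Derivations *)

Notation "G ⊢ a" := (prv set_theory G a) (at level 80, a at next level).

Lemma up_ext r s : (forall n, r n = s n) -> forall n, up r n = up s n.
Proof. intros H [|n]; simpl; auto. Qed.

Lemma ren_ext a : forall r s, (forall n, r n = s n) -> ren r a = ren s a.
Proof. induction a; simpl; intros r s H; f_equal; auto using up_ext. Qed.

Lemma ren_ren a : forall r s, ren r (ren s a) = ren (fun n => r (s n)) a.
Proof.
  induction a; simpl; intros r s; f_equal; auto;
    rewrite IHa; apply ren_ext; intros [|n]; reflexivity.
Qed.

Lemma ren_id a : forall r, (forall n, r n = n) -> ren r a = a.
Proof.
  induction a; simpl; intros r H; f_equal; auto;
    apply IHa; intros [|n]; simpl; auto.
Qed.

Lemma ren_shift r a : ren (up r) (shift a) = shift (ren r a).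
Proof. unfold shift. now rewrite !ren_ren. Qed.

Lemma map_ren_shift r G : map (ren (up r)) (map shift G) = map shift (map (ren r) G).
Proof. rewrite !map_map. apply map_ext. intros; apply ren_shift. Qed.

Lemma ren_inst r t a : ren r (inst t a) = inst (r t) (ren (up r) a).
Proof. unfold inst. rewrite !ren_ren. apply ren_ext. intros [|n]; reflexivity. Qed.

Definition scons (x : nat) (env : nat -> nat) (n : nat) : nat :=
  match n with 0 => x | S n => env n end.

Lemma inst_up t r a : inst t (ren (up r) a) = ren (scons t r) a.
Proof. unfold inst. rewrite ren_ren. apply ren_ext. intros [|n]; reflexivity. Qed.

Lemma bounded_ren a : bounded a -> forall r, bounded (ren r a).
Proof. induction 1; intros r; simpl; constructor; auto. Qed.

(** All axioms but separation are closed. Renaming an instance of separation gives the instance for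
    a renamed formula, in which index 0 is kept because it is the bound element. *)
Lemma set_theory_ren r a : set_theory a -> set_theory (ren r a).
Proof.
  destruct 1; try solve [constructor].
  replace (ren r (separation P)) with (separation (ren (up r) P)).
  - constructor. now apply bounded_ren.
  - unfold separation. simpl.
    rewrite !ren_ren.
    rewrite (ren_ext P _ (fun x => up (up (up r)) (match x with 0 => 0 | S n => S (S (S n)) end))).
    + reflexivity.
    + intros [|n]; reflexivity.
Qed.

Lemma prv_ren G a : G ⊢ a -> forall r, map (ren r) G ⊢ ren r a.
Proof.
  induction 1; intros r; simpl in *.
  - apply prv_ax. now apply set_theory_ren.
  - apply prv_hyp. now apply in_map.
  - apply prv_botE. apply IHprv.
  - apply prv_andI; auto.
  - eapply prv_andL; apply IHprv.
  - eapply prv_andR; apply IHprv.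
  - apply prv_orL; auto.
  - apply prv_orR; auto.
  - eapply prv_orE; [apply IHprv1|apply IHprv2|apply IHprv3].
  - apply prv_impI; apply IHprv.
  - eapply prv_impE; [apply IHprv1|apply IHprv2].
  - apply prv_allI. rewrite <- map_ren_shift. apply IHprv.
  - rewrite ren_inst. apply prv_allE. apply IHprv.
  - apply prv_exI with (r t). rewrite <- ren_inst. apply IHprv.
  - eapply prv_exE; [apply IHprv1|]. rewrite <- map_ren_shift, <- ren_shift. apply IHprv2.
  - apply prv_eqI.
  - rewrite ren_inst. eapply prv_eqE; [apply IHprv1|]. rewrite <- ren_inst. apply IHprv2.
Qed.

Lemma prv_weaken G a : G ⊢ a -> forall G', incl G G' -> G' ⊢ a.
Proof.
  induction 1; intros G' HG;
    try solve [econstructor; eauto using incl_map].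
  - eapply prv_orE; [apply IHprv1|apply IHprv2|apply IHprv3]; auto;
      intros z [->|Hz]; simpl; auto.
  - apply prv_impI, IHprv. intros z [->|Hz]; simpl; auto.
  - eapply prv_exE; [apply IHprv1; auto|apply IHprv2].
    intros z [->|Hz]; simpl; auto. right. revert Hz. now apply incl_map.
Qed.

(** A formula mentions finitely many variables. Support is phrased through renamings because
    freshness is only used to replace one renaming by another. *)
Lemma form_support a : exists N, forall r s, (forall n, n < N -> r n = s n) -> ren r a = ren s a.
Proof.
  induction a as [|x y|x y|a [N1 H1] b [N2 H2]|a [N1 H1] b [N2 H2]
                 |a [N1 H1] b [N2 H2]|a [N H]|a [N H]].
  - now exists 0.
  - exists (S (x + y)). intros r s E. simpl. rewrite !E; auto; lia.
  - exists (S (x + y)). intros r s E. simpl. rewrite !E; auto; lia.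
  - exists (N1 + N2). intros r s E. simpl. f_equal; [apply H1|apply H2]; intros; apply E; lia.
  - exists (N1 + N2). intros r s E. simpl. f_equal; [apply H1|apply H2]; intros; apply E; lia.
  - exists (N1 + N2). intros r s E. simpl. f_equal; [apply H1|apply H2]; intros; apply E; lia.
  - exists N. intros r s E. simpl. f_equal. apply H. intros [|n] Hn; simpl; auto.
    f_equal. apply E. lia.
  - exists N. intros r s E. simpl. f_equal. apply H. intros [|n] Hn; simpl; auto.
    f_equal. apply E. lia.
Qed.

Lemma context_support G :
  exists N, forall a, In a G -> forall r s, (forall n, n < N -> r n = s n) -> ren r a = ren s a.
Proof.
  induction G as [|a G [N HG]].
  - exists 0. intros a [].
  - destruct (form_support a) as [M Ha]. exists (M + N).
    intros b [<-|Hb] r s E; [apply Ha|apply (HG b Hb)]; intros; apply E; lia.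
Qed.

(* A variable outside the support of the context serves as an eigenvariable. *)
Lemma generalize_fresh G a :
  exists t r, map (ren r) G = map shift G /\ ren r (inst t a) = a.
Proof.
  destruct (context_support (All a :: G)) as [N HN].
  (* The renaming captures the fresh variable [N] as the new index 0 and agrees with [S] below [N],
     hence on the whole context. *)
  exists N, (fun n => if n =? N then 0 else S n). split.
  - apply map_ext_in. intros b Hb. apply (HN b); [now right|].
    intros n Hn. destruct (Nat.eqb_spec n N); [lia|reflexivity].
  - assert (E := HN (All a) (or_introl eq_refl)
                    (fun n => if n =? N then 0 else S n) S).
    unfold inst. rewrite ren_ren.
    assert (E' : ren (up (fun n => if n =? N then 0 else S n)) a = ren (up S) a).
    { simpl in E. injection E; auto.
      intros n Hn. destruct (Nat.eqb_spec n N); [lia|reflexivity]. }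
    (* Predecessor after [up S] is the identity; after [up] of the chosen renaming it has the effect
       of instantiating with [N] and then renaming. *)
    apply (f_equal (ren (fun n => match n with 0 => 0 | S n => n end))) in E'.
    rewrite !ren_ren in E'.
    transitivity (ren (fun n => n) a); [|now apply ren_id].
    etransitivity; [|etransitivity; [exact E'|]].
    + apply ren_ext. intros [|n]; simpl; [now rewrite Nat.eqb_refl|reflexivity].
    + apply ren_ext. now intros [|n].
Qed.

(** A derivation for one fresh [t] is enough: the renaming that turns [t] into index 0 carries it to
    the premise of [prv_allI]. This gives universal quantification a pointwise meaning over
    variables. *)
Lemma prv_all G a : (forall t, G ⊢ inst t a) -> G ⊢ All a.
Proof.
  intros H. destruct (generalize_fresh G a) as (t & r & HG & Ha).
  apply prv_allI. rewrite <- HG, <- Ha. apply prv_ren, H.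
Qed.

Lemma prv_ex G a b : G ⊢ Ex a -> (forall t, inst t a :: G ⊢ b) -> G ⊢ b.
Proof.
  (* [b] joins the context so that the eigenvariable is fresh for the conclusion too. *)
  intros H1 H2. destruct (generalize_fresh (b :: G) a) as (t & r & HG & Ha).
  simpl in HG. injection HG as Hb HG.
  eapply prv_exE; [exact H1|]. rewrite <- Ha at 1. rewrite <- HG, <- Hb.
  apply (prv_ren _ _ (H2 t)).
Qed.

(** * Forcing *)

Definition world := list form.

(* [tr_local] is what allows disjunctions and existential statements, known only inside derivations
   of formulas [c], to be eliminated towards an arbitrary proposition. *)
Record prop := Prop_ {
  tr : world -> Prop;
  tr_mono : forall w w', incl w w' -> tr w -> tr w';
  tr_local : forall w,
    (forall w1 c, incl w w1 -> (forall w2, incl w1 w2 -> tr w2 -> w2 ⊢ c) -> w1 ⊢ c) -> tr w }.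

Notation "w ⊩ P" := (tr P w) (at level 100, P at level 200).

Program Definition atom (a : form) : prop := {| tr w := w ⊢ a |}.
Next Obligation. eauto using prv_weaken. Qed.
Next Obligation. apply H; auto using incl_refl. Qed.

Program Definition pand (P Q : prop) : prop := {| tr w := (w ⊩ P) /\ (w ⊩ Q) |}.
Next Obligation. split; eauto using tr_mono. Qed.
Next Obligation.
  split; apply tr_local; intros w1 c Hw Hc; apply H; auto; intros w2 Hw2 [? ?]; auto.
Qed.

Program Definition pimp (P Q : prop) : prop :=
  {| tr w := forall w', incl w w' -> (w' ⊩ P) -> (w' ⊩ Q) |}.
Next Obligation. eauto using incl_tran. Qed.
Next Obligation.
  apply tr_local; intros w1 c Hw Hc; apply H; eauto using incl_tran.
  intros w2 Hw2 HPQ. apply Hc; auto. apply HPQ; auto using incl_refl.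
  eauto using tr_mono, incl_tran.
Qed.

Program Definition pall (P : nat -> prop) : prop := {| tr w := forall x, w ⊩ P x |}.
Next Obligation. eauto using tr_mono. Qed.
Next Obligation. apply tr_local; intros w1 c Hw Hc; apply H; auto. Qed.

(** Disjunction is given by its elimination into derivations, not by a choice of side: a context
    containing [Or a b] need not derive either disjunct. [pex] is encoded likewise. *)
Program Definition por (P Q : prop) : prop :=
  {| tr w := forall w1 c, incl w w1 ->
       (forall w2, incl w1 w2 -> (w2 ⊩ P) -> w2 ⊢ c) ->
       (forall w2, incl w1 w2 -> (w2 ⊩ Q) -> w2 ⊢ c) -> w1 ⊢ c |}.
Next Obligation. eauto using incl_tran. Qed.
Next Obligation.
  apply H; auto. intros w2 Hw2 HPQ. apply HPQ; eauto using incl_tran, incl_refl.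
Qed.

Program Definition pex (P : nat -> prop) : prop :=
  {| tr w := forall w1 c, incl w w1 ->
       (forall x w2, incl w1 w2 -> (w2 ⊩ P x) -> w2 ⊢ c) -> w1 ⊢ c |}.
Next Obligation. eauto using incl_tran. Qed.
Next Obligation.
  apply H; auto. intros w2 Hw2 HPQ. apply HPQ; eauto using incl_tran, incl_refl.
Qed.

Definition pbot := atom Bot.
Definition peq x y := atom (Eq x y).
Definition pmem x y := atom (Mem x y).

Lemma bot_e w P : (w ⊩ pbot) -> w ⊩ P.
Proof.
  intros H. apply tr_local. intros w1 c Hw _. apply prv_botE.
  exact (prv_weaken _ _ H _ Hw).
Qed.

Lemma or_l w P Q : (w ⊩ P) -> w ⊩ por P Q.
Proof. intros H w1 c Hw H1 _. apply H1; eauto using incl_refl, tr_mono. Qed.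
Lemma or_r w P Q : (w ⊩ Q) -> w ⊩ por P Q.
Proof. intros H w1 c Hw _ H1. apply H1; eauto using incl_refl, tr_mono. Qed.
Lemma or_e w P Q R : (w ⊩ por P Q) ->
  (forall w', incl w w' -> (w' ⊩ P) -> w' ⊩ R) ->
  (forall w', incl w w' -> (w' ⊩ Q) -> w' ⊩ R) -> w ⊩ R.
Proof.
  intros H HP HQ. apply tr_local. intros w1 c Hw Hc. apply H; auto.
  - intros w2 Hw2 H2. apply Hc; eauto using incl_tran.
  - intros w2 Hw2 H2. apply Hc; eauto using incl_tran.
Qed.
Lemma ex_i w (P : nat -> prop) x : (w ⊩ P x) -> w ⊩ pex P.
Proof. intros H w1 c Hw H1. apply (H1 x); eauto using incl_refl, tr_mono. Qed.
Lemma ex_e w (P : nat -> prop) R : (w ⊩ pex P) ->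
  (forall x w', incl w w' -> (w' ⊩ P x) -> w' ⊩ R) -> w ⊩ R.
Proof.
  intros H HP. apply tr_local. intros w1 c Hw Hc. apply H; auto.
  intros x w2 Hw2 H2. apply Hc; eauto using incl_tran.
Qed.
Definition imp_e {w P Q} (H : w ⊩ pimp P Q) (h : w ⊩ P) : w ⊩ Q := H w (incl_refl w) h.

Fixpoint sem (a : form) (env : nat -> nat) : prop :=
  match a with
  | Bot => pbot
  | Eq x y => peq (env x) (env y)
  | Mem x y => pmem (env x) (env y)
  | And a b => pand (sem a env) (sem b env)
  | Or a b => por (sem a env) (sem b env)
  | Imp a b => pimp (sem a env) (sem b env)
  | All a => pall (fun x => sem a (scons x env))
  | Ex a => pex (fun x => sem a (scons x env))
  end.

(** Soundness and completeness in one. Hypotheses are introduced by passing to the world enlarged by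
    them, and the quantifiers rest on [prv_all] and [prv_ex]. *)
Lemma sem_prv a : forall env w, (w ⊩ sem a env) <-> w ⊢ ren env a.
Proof.
  induction a; intros env w.
  1-3: reflexivity.
  - simpl. rewrite IHa1, IHa2. split.
    + intros []; now apply prv_andI.
    + intros H; split; [eapply prv_andL|eapply prv_andR]; exact H.
  - split.
    + intros H. apply H; [apply incl_refl| |]; intros w2 _ H2; simpl.
      * apply prv_orL. now apply IHa1.
      * apply prv_orR. now apply IHa2.
    + intros H w1 c Hw H1 H2. simpl in H.
      eapply prv_orE; [exact (prv_weaken _ _ H _ Hw)| |].
      * apply H1; [now apply incl_tl, incl_refl|]. apply IHa1, prv_hyp. now left.
      * apply H2; [now apply incl_tl, incl_refl|]. apply IHa2, prv_hyp. now left.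
  - split.
    + intros H. simpl. apply prv_impI. apply IHa2. apply H; [now apply incl_tl, incl_refl|].
      apply IHa1, prv_hyp. now left.
    + intros H w' Hw H1. apply IHa2. apply IHa1 in H1. simpl in H.
      eapply prv_impE; [exact (prv_weaken _ _ H _ Hw)|exact H1].
  - split.
    + intros H. simpl. apply prv_all. intros t. rewrite inst_up. apply IHa, H.
    + intros H x. apply IHa. rewrite <- inst_up. apply prv_allE, H.
  - split.
    + intros H. apply H; [apply incl_refl|]. intros x w2 _ H2. simpl.
      apply prv_exI with x. rewrite inst_up. now apply IHa.
    + intros H w1 c Hw H1. simpl in H. eapply prv_ex; [exact (prv_weaken _ _ H _ Hw)|].
      intros t. rewrite inst_up. apply (H1 t); [now apply incl_tl, incl_refl|].
      apply IHa, prv_hyp. now left.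
Qed.

(** * Definability *)

Definition ball (a : nat) (P : nat -> prop) : prop := pall (fun x => pimp (pmem x a) (P x)).
Definition bex (a : nat) (P : nat -> prop) : prop := pex (fun x => pand (pmem x a) (P x)).

(* A bounded formula defines a [Q] depending on an environment in which the first [k] entries are the
   bound variables and entry [k + n] is the free variable [n]; constants are thus terms as well. *)
Definition constants_from (k : nat) (env : nat -> nat) : Prop := forall n, env (k + n) = n.

Definition Term (k : nat) (t : (nat -> nat) -> nat) : Prop :=
  exists i, forall env, constants_from k env -> t env = env i.

Definition Bd (k : nat) (Q : (nat -> nat) -> prop) : Prop :=
  exists a, bounded a /\ forall env, constants_from k env ->
    forall w, (w ⊩ Q env) <-> (w ⊩ sem a env).

(** Closing under all terms at every depth [k] lets a definable predicate be used below the binders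
    of another formula. *)
Definition Bd1 (Q : nat -> prop) : Prop :=
  forall k s, Term k s -> Bd k (fun env => Q (s env)).
Definition Bd2 (Q : nat -> nat -> prop) : Prop :=
  forall k s t, Term k s -> Term k t -> Bd k (fun env => Q (s env) (t env)).
Definition Bd3 (Q : nat -> nat -> nat -> prop) : Prop :=
  forall k s t u, Term k s -> Term k t -> Term k u ->
    Bd k (fun env => Q (s env) (t env) (u env)).

Lemma Term_local k i : Term k (fun env => env i).
Proof. exists i. auto. Qed.

Lemma Term_const k c : Term k (fun _ => c).
Proof. exists (k + c). auto. Qed.

Lemma Term_shift j k t : Term k t -> Term (j + k) (fun env => t (fun n => env (j + n))).
Proof.
  intros [i Hi]. exists (j + i). intros env He.
  rewrite (Hi (fun n => env (j + n))); [reflexivity|].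
  intros n. rewrite <- (He n) at 2. f_equal. lia.
Qed.

Lemma Bd_atoms k s t : Term k s -> Term k t ->
  Bd k (fun _ => pbot) /\
  Bd k (fun env => peq (s env) (t env)) /\ Bd k (fun env => pmem (s env) (t env)).
Proof.
  intros [i Hi] [j Hj]. repeat split.
  - exists Bot. split; [constructor|reflexivity].
  - exists (Eq i j). split; [constructor|]. intros env He w. now rewrite (Hi env He), (Hj env He).
  - exists (Mem i j). split; [constructor|]. intros env He w. now rewrite (Hi env He), (Hj env He).
Qed.

Lemma Bd_bot k : Bd k (fun _ => pbot).
Proof. apply (Bd_atoms k (fun _ => 0) (fun _ => 0)); apply Term_const. Qed.
Lemma Bd_eq k s t : Term k s -> Term k t -> Bd k (fun env => peq (s env) (t env)).
Proof. intros Hs Ht. apply (Bd_atoms k s t Hs Ht). Qed.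
Lemma Bd_mem k s t : Term k s -> Term k t -> Bd k (fun env => pmem (s env) (t env)).
Proof. intros Hs Ht. apply (Bd_atoms k s t Hs Ht). Qed.

Lemma Bd_and k P Q : Bd k P -> Bd k Q -> Bd k (fun env => pand (P env) (Q env)).
Proof.
  intros (a & Ba & Ha) (b & Bb & Hb). exists (And a b). split; [now constructor|].
  intros env He w. simpl. now rewrite (Ha env He), (Hb env He).
Qed.

Lemma or_iff w P Q P' Q' :
  (forall w, (w ⊩ P) <-> (w ⊩ P')) -> (forall w, (w ⊩ Q) <-> (w ⊩ Q')) ->
  (w ⊩ por P Q) <-> (w ⊩ por P' Q').
Proof.
  intros HP HQ. split; intros H; apply (or_e _ _ _ _ H); intros w' _ H'.
  - apply or_l, HP, H'.
  - apply or_r, HQ, H'.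
  - apply or_l, HP, H'.
  - apply or_r, HQ, H'.
Qed.

Lemma Bd_or k P Q : Bd k P -> Bd k Q -> Bd k (fun env => por (P env) (Q env)).
Proof.
  intros (a & Ba & Ha) (b & Bb & Hb). exists (Or a b). split; [now constructor|].
  intros env He w. apply or_iff; auto.
Qed.

Lemma Bd_imp k P Q : Bd k P -> Bd k Q -> Bd k (fun env => pimp (P env) (Q env)).
Proof.
  intros (a & Ba & Ha) (b & Bb & Hb). exists (Imp a b). split; [now constructor|].
  intros env He w. split; intros H w' Hw H'; apply Hb, H, Ha; auto.
Qed.

Lemma constants_scons k env x : constants_from k env -> constants_from (S k) (scons x env).
Proof. intros H n. apply H. Qed.

Lemma Bd_ball k t (P : nat -> (nat -> nat) -> prop) : Term k t ->
  Bd (S k) (fun env => P (env 0) (fun n => env (S n))) ->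
  Bd k (fun env => ball (t env) (fun x => P x env)).
Proof.
  intros [i Hi] (a & Ba & Ha). exists (All (Imp (Mem 0 (S i)) a)). split; [now constructor|].
  intros env He w. rewrite (Hi env He).
  split; intros H x w' Hw H'; [|change (w' ⊩ (fun env => P (env 0) (fun n => env (S n))) (scons x env))];
    apply (Ha (scons x env) (constants_scons _ _ x He)); apply H; auto.
Qed.

Lemma Bd_bex k t (P : nat -> (nat -> nat) -> prop) : Term k t ->
  Bd (S k) (fun env => P (env 0) (fun n => env (S n))) ->
  Bd k (fun env => bex (t env) (fun x => P x env)).
Proof.
  intros [i Hi] (a & Ba & Ha). exists (Ex (And (Mem 0 (S i)) a)). split; [now constructor|].
  intros env He w. rewrite (Hi env He).
  split; intros H; apply (ex_e _ _ _ H); intros x w' Hw [H1 H2]; apply ex_i with x; split; auto;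
  apply (Ha (scons x env) (constants_scons _ _ x He)); auto.
Qed.

(** A derivable equality can be substituted only inside a formula, so [Q] has to be equivalent to
    one. At depth 1 the environment [scons z (fun n => n)] turns that formula into its instance at
    [z]. *)
Lemma eq_subst (Q : nat -> prop) (HQ : Bd1 Q) w x y :
  (w ⊩ peq x y) -> (w ⊩ Q x) -> w ⊩ Q y.
Proof.
  destruct (HQ 1 (fun env => env 0) (Term_local 1 0)) as (a & _ & Ha).
  intros E H.
  assert (He : forall z, constants_from 1 (scons z (fun n => n))) by (intros z n; reflexivity).
  apply (Ha _ (He y)), sem_prv. apply (Ha _ (He x)), sem_prv in H.
  exact (prv_eqE _ _ _ _ _ E H).
Qed.

(** * Set-theoretic vocabulary *)

Declare Scope pr_scope.
Delimit Scope pr_scope with pr.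
Bind Scope pr_scope with prop.
Notation "x ≐ y" := (peq x y) : pr_scope.
Notation "x ∈ y" := (pmem x y) : pr_scope.
Notation "a ∧ b" := (pand a b) : pr_scope.
Notation "a ∨ b" := (por a b) : pr_scope.
Notation "a → b" := (pimp a b) : pr_scope.
Notation "¬ a" := (pimp a pbot) : pr_scope.
Notation "a ↔ b" := (pand (pimp a b) (pimp b a)) : pr_scope.
Notation "∀ x .. y , P" := (pall (fun x => .. (pall (fun y => P%pr)) ..)) : pr_scope.
Notation "∃ x .. y , P" := (pex (fun x => .. (pex (fun y => P%pr)) ..)) : pr_scope.
Notation "∀[ a ] x .. y , P" :=
  (ball a (fun x => .. (ball a (fun y => P%pr)) ..)) : pr_scope.
Notation "∃[ a ] x .. y , P" :=
  (bex a (fun x => .. (bex a (fun y => P%pr)) ..)) : pr_scope.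
Local Open Scope pr_scope.

(* The capitalised predicates unfold to the interpretations of the formulas of the statement. *)
Definition Sub a b : prop := ∀[a] x, x ∈ b.
Definition Empty e : prop := ∀[e] x, pbot.
Definition Upair z x y : prop := x ∈ z ∧ y ∈ z ∧ ∀[z] w, w ≐ x ∨ w ≐ y.
Definition Pair p x y : prop :=
  (∃[p] z, Upair z x x) ∧ (∃[p] z, Upair z x y) ∧ (∀[p] z, Upair z x x ∨ Upair z x y).
Definition Rel r x y : prop := ∃[r] p, Pair p x y.
Definition Succ m n : prop := n ∈ m ∧ (∀[n] k, k ∈ m) ∧ (∀[m] k, k ∈ n ∨ k ≐ n).
Definition InductiveSet i : prop := (∃[i] z, Empty z) ∧ (∀[i] n, ∃[i] m, Succ m n).
Definition NatSet N : prop := InductiveSet N ∧ ∀ i, InductiveSet i → Sub N i.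
Definition Fun f A B : prop :=
  (∀[f] p, ∃[A] x, ∃[B] y, Pair p x y) ∧
  (∀[A] x, ∃[B] y, Rel f x y ∧ ∀[B] y', Rel f x y' → y' ≐ y).
Definition Inj f A B : prop :=
  Fun f A B ∧ ∀[A] x x', ∀[B] y, Rel f x y → Rel f x' y → x ≐ x'.
Definition Bij f A B : prop := Inj f A B ∧ ∀[B] y, ∃[A] x, Rel f x y.
Definition FunSet E A B : prop := ∀ f, f ∈ E ↔ Fun f B A.
Definition Preimage A f B X : prop := ∀ x, x ∈ A ↔ x ∈ X ∧ ∃[B] y, Rel f x y.
Definition Restr h A B : prop := ∃ k, Sub k h ∧ Bij k A B.
Definition Comp k g f X : prop :=
  Fun k X X ∧ ∀[X] x y z, Rel f x y → Rel g y z → Rel k x z.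
Definition Iter N X k n x y : prop :=
  ∃ t, Fun t N X ∧ (∀[N] z, Empty z → Rel t z x) ∧
    (∀[N] i j, Succ j i → ∀[X] u v, Rel t i u → Rel t j v → Rel k u v) ∧ Rel t n y.
Definition Myhill X : prop :=
  ∀ A B, Sub A X → Sub B X → ∀ f g, Inj f X X → Inj g X X →
    Preimage A f B X → Preimage B g A X → ∃ h, Bij h X X ∧ Restr h A B.
Definition RNonneg N X f g n x y : prop :=
  ∃ k, Comp k g f X ∧ ∃[X] u, Iter N X k n x u ∧ Rel f u y.
Definition RNeg N X f g n x y : prop :=
  ∃ k, Comp k f g X ∧ ∃[X] u, Iter N X k n y u ∧ Rel g u x.
Definition StrongMyhill N X : prop :=
  ∀ f g, Inj f X X → Inj g X X →
  ∃ h, Bij h X X ∧ ∀[X] x y, Rel h x y → ∃[N] n, RNonneg N X f g n x y ∨ RNeg N X f g n x y.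
Definition ExcludedMiddle : prop := ∀ e, Empty e → ∀ p, (∀[p] x, x ≐ e) → e ∈ p ∨ ¬ e ∈ p.

Lemma provable_sem (a : fm) : (nil ⊩ sem (a 0) (fun n => n)) -> provable a.
Proof. intros H. apply sem_prv in H. now rewrite ren_id in H. Qed.

(* All hypotheses are kept at one current world [w]; introducing a premise moves to a larger world
   and carries the hypotheses along. *)
Ltac lift l :=
  lazymatch type of l with incl ?w ?w' =>
    repeat match goal with H : tr _ w |- _ => apply (tr_mono _ _ _ l) in H end;
    clear l; try clear w; try rename w' into w
  end.

Ltac wi_core :=
  let z := fresh "hyp_w" in intro z;
  let T := type of z in lazymatch eval unfold world in T with
  | list _ => let l := fresh "le_w" in let h := fresh "hyp_w" in
             intros l h; lift l; revert h
  | _ => revert z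
  end.
Tactic Notation "wi" simple_intropattern(p) := wi_core; intros p.
Tactic Notation "wi" simple_intropattern(p1) simple_intropattern(p2) :=
  wi p1; wi p2.
Tactic Notation "wi" simple_intropattern(p1) simple_intropattern(p2) simple_intropattern(p3) :=
  wi p1 p2; wi p3.
Tactic Notation "wi" simple_intropattern(p1) simple_intropattern(p2) simple_intropattern(p3)
  simple_intropattern(p4) :=
  wi p1 p2 p3; wi p4.
Tactic Notation "wi" simple_intropattern(p1) simple_intropattern(p2) simple_intropattern(p3)
  simple_intropattern(p4) simple_intropattern(p5) :=
  wi p1 p2 p3 p4; wi p5.
Tactic Notation "wi" simple_intropattern(p1) simple_intropattern(p2) simple_intropattern(p3)
  simple_intropattern(p4) simple_intropattern(p5) simple_intropattern(p6) :=
  wi p1 p2 p3 p4 p5; wi p6.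
Tactic Notation "wi" simple_intropattern(p1) simple_intropattern(p2) simple_intropattern(p3)
  simple_intropattern(p4) simple_intropattern(p5) simple_intropattern(p6)
  simple_intropattern(p7) :=
  wi p1 p2 p3 p4 p5 p6; wi p7.
Tactic Notation "wi" simple_intropattern(p1) simple_intropattern(p2) simple_intropattern(p3)
  simple_intropattern(p4) simple_intropattern(p5) simple_intropattern(p6)
  simple_intropattern(p7) simple_intropattern(p8) :=
  wi p1 p2 p3 p4 p5 p6 p7; wi p8.

Tactic Notation "wor" constr(H) "as" simple_intropattern(p) "|" simple_intropattern(q) :=
  let w' := fresh "w" in let l := fresh "le_w" in let h := fresh "hyp_w" in
  refine (or_e _ _ _ _ H _ _); try clear H; intros w' l h; lift l; revert h; [intros p|intros q].

Tactic Notation "wex" constr(H) "as" ident(x) simple_intropattern(p) :=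
  let w' := fresh "w" in let l := fresh "le_w" in let h := fresh "hyp_w" in
  refine (ex_e _ _ _ H _); try clear H; intros x w' l h; lift l; revert h; intros p.

(* Backward application through quantifiers, implications and conjunctions. *)
Ltac wa_go h :=
  first
  [ exact h
  | let x := fresh in evar (x : nat); let x' := eval unfold x in x in
    specialize (h x'); clear x; wa_go h
  | lazymatch type of (imp_e h) with tr ?P ?w -> _ =>
      let hp := fresh in
      assert (hp : tr P w); [clear h | apply (imp_e h) in hp; clear h; wa_go hp]
    end
  | let h1 := fresh in pose proof (proj1 h) as h1; clear h; wa_go h1
  | let h1 := fresh in pose proof (proj2 h) as h1; clear h; wa_go h1 ].
Tactic Notation "wa" constr(H) := let h := fresh in pose proof H as h; wa_go h.

Tactic Notation "wx" constr(x) := refine (ex_i _ _ x _).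

(** * Automatic recognition of bounded definability *)

Ltac bd_term :=
  first
  [ assumption
  | match goal with Ht : Term ?k ?t |- _ =>
      first [exact (Term_shift 1 k t Ht) | exact (Term_shift 2 k t Ht) | exact (Term_shift 3 k t Ht)
            | exact (Term_shift 4 k t Ht) | exact (Term_shift 5 k t Ht) | exact (Term_shift 6 k t Ht)]
    end
  | apply Term_local
  | apply Term_const ].

Create HintDb bd.
Ltac bd :=
  intros; cbv beta;
  lazymatch goal with
  | |- Bd1 _ => intros ? ? ?; bd
  | |- Bd2 _ => intros ? ? ? ? ?; bd
  | |- Bd3 _ => intros ? ? ? ? ? ? ?; bd
  | |- Term _ _ => bd_term
  | |- Bd _ (fun _ => pbot) => apply Bd_bot
  | |- Bd _ (fun env => peq _ _) => apply Bd_eq; bd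
  | |- Bd _ (fun env => pmem _ _) => apply Bd_mem; bd
  | |- Bd _ (fun env => pand _ _) => apply Bd_and; bd
  | |- Bd _ (fun env => por _ _) => apply Bd_or; bd
  | |- Bd _ (fun env => pimp _ _) => apply Bd_imp; bd
  | |- Bd _ (fun env => ball _ _) => apply Bd_ball; bd
  | |- Bd _ (fun env => bex _ _) => apply Bd_bex; bd
  | |- Bd _ _ =>
    first
    [ match goal with
      | H : Bd1 _ |- _ => apply H; bd
      | H : Bd2 _ |- _ => apply H; bd
      | H : Bd3 _ |- _ => apply H; bd
      end
    | solve [eauto 2 with bd nocore] ]
  end.
#[local] Hint Extern 1 (Term _ _) => bd_term : bd.

Lemma Bd_Sub k a b : Term k a -> Term k b -> Bd k (fun v => Sub (a v) (b v)).
Proof. intros. unfold Sub. bd. Qed.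
#[local] Hint Resolve Bd_Sub : bd.
Lemma Bd_Empty k a : Term k a -> Bd k (fun v => Empty (a v)).
Proof. intros. unfold Empty. bd. Qed.
#[local] Hint Resolve Bd_Empty : bd.
Lemma Bd_Upair k a b c : Term k a -> Term k b -> Term k c -> Bd k (fun v => Upair (a v) (b v) (c v)).
Proof. intros. unfold Upair. bd. Qed.
#[local] Hint Resolve Bd_Upair : bd.
Lemma Bd_Pair k a b c : Term k a -> Term k b -> Term k c -> Bd k (fun v => Pair (a v) (b v) (c v)).
Proof. intros. unfold Pair. bd. Qed.
#[local] Hint Resolve Bd_Pair : bd.
Lemma Bd_Rel k a b c : Term k a -> Term k b -> Term k c -> Bd k (fun v => Rel (a v) (b v) (c v)).
Proof. intros. unfold Rel. bd. Qed.
#[local] Hint Resolve Bd_Rel : bd.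
Lemma Bd_Succ k a b : Term k a -> Term k b -> Bd k (fun v => Succ (a v) (b v)).
Proof. intros. unfold Succ. bd. Qed.
#[local] Hint Resolve Bd_Succ : bd.
Lemma Bd_Fun k a b c : Term k a -> Term k b -> Term k c -> Bd k (fun v => Fun (a v) (b v) (c v)).
Proof. intros. unfold Fun. bd. Qed.
#[local] Hint Resolve Bd_Fun : bd.
Lemma Bd_Inj k a b c : Term k a -> Term k b -> Term k c -> Bd k (fun v => Inj (a v) (b v) (c v)).
Proof. intros. unfold Inj. bd. Qed.
#[local] Hint Resolve Bd_Inj : bd.

(** * Equality and rewriting inside the logic *)

Lemma peq_refl w x : w ⊩ x ≐ x.
Proof. apply prv_eqI. Qed.
Lemma peq_sym w x y : (w ⊩ x ≐ y) -> w ⊩ y ≐ x.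
Proof. intros E. refine (eq_subst (fun z => z ≐ x) _ w x y E (peq_refl w x)). bd. Qed.
Lemma peq_trans w x y z : (w ⊩ x ≐ y) -> (w ⊩ y ≐ z) -> w ⊩ x ≐ z.
Proof. intros E F. refine (eq_subst (fun z => x ≐ z) _ w y z F E). bd. Qed.

(* Rewriting abstracts the left-hand side out of the proposition and discharges the definability
   premise of [eq_subst] with [bd]; it therefore reaches bounded propositions only. *)
Tactic Notation "rew" constr(E) "in" hyp(H) :=
  lazymatch type of E with tr (peq ?x ?y) ?w =>
  lazymatch type of H with tr ?P _ =>
  lazymatch eval pattern x in P with ?Q _ =>
    let h := fresh in
    pose proof (eq_subst Q ltac:(bd) w x y E H) as h; cbv beta in h; clear H; rename h into H
  end end end.
Tactic Notation "rew" constr(E) :=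
  lazymatch type of E with tr (peq ?x ?y) ?w =>
  lazymatch goal with |- tr ?P _ =>
  lazymatch eval pattern x in P with ?Q _ =>
    refine (eq_subst Q ltac:(bd) w y x (peq_sym _ _ _ E) _); cbv beta
  end end end.
Ltac ws E :=
  lazymatch type of E with tr (peq ?x ?y) ?w =>
    repeat match goal with H : tr ?P w |- _ =>
      lazymatch H with E => fail | _ =>
      lazymatch P with context [x] => rew E in H end end
    end;
    try (lazymatch goal with |- tr ?P w => lazymatch P with context [x] => rew E end end);
    clear E; try clear x
  end.

(** * Pairs and functions *)

Lemma axiom_sem w (a : fm) : set_theory (a 0) -> w ⊩ sem (a 0) (fun n => n).
Proof. intros H. apply sem_prv. rewrite ren_id by auto. now apply prv_ax. Qed.

Lemma ext w a b : (w ⊩ ∀ x, x ∈ a ↔ x ∈ b) -> w ⊩ a ≐ b.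
Proof.
  intros H.
  pose proof (axiom_sem w extensionality ax_extensionality) as A. exact (imp_e (A a b) H).
Qed.
Lemma pairing_ax w a b : w ⊩ ∃ c, ∀ x, x ∈ c ↔ x ≐ a ∨ x ≐ b.
Proof.
  pose proof (axiom_sem w pairing ax_pairing) as A. exact (A a b).
Qed.
Lemma union_ax w a : w ⊩ ∃ b, ∀ x, x ∈ b ↔ ∃[a] y, x ∈ y.
Proof.
  pose proof (axiom_sem w union ax_union) as A. exact (A a).
Qed.
Lemma powerset_ax w a : w ⊩ ∃ b, ∀ x, x ∈ b ↔ Sub x a.
Proof.
  pose proof (axiom_sem w powerset ax_powerset) as A. exact (A a).
Qed.
Lemma sep (Q : nat -> prop) w a : Bd1 Q -> w ⊩ ∃ b, ∀ x, x ∈ b ↔ x ∈ a ∧ Q x.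
Proof.
  intros HQ.
  (* At depth 1, index 0 is the element and the remaining indices are parameters, which is the
     format that [separation] expects. *)
  destruct (HQ 1 (fun env => env 0) (Term_local 1 0)) as (P & BP & HP).
  assert (H : w ⊩ sem (separation P) (fun n => n)).
  { apply sem_prv. rewrite ren_id; auto. apply prv_ax. now constructor. }
  refine (ex_e _ _ _ (H a) _). intros b w' Hw Hb. apply ex_i with b. intros x.
  specialize (Hb x).
  (* The renaming in [separation] skips the entries [b] and [a] of the environment, so the value of
     [P] does not depend on them. *)
  assert (HQP : forall w, (w ⊩ sem (ren (fun n => match n with 0 => 0 | S n => S (S (S n)) end) P)
                    (scons x (scons b (scons a (fun n => n))))) <-> (w ⊩ Q x)).
  { intros v. rewrite sem_prv, ren_ren.
    rewrite (HP (scons x (fun n => n)) (fun n => eq_refl) v), sem_prv.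
    rewrite (ren_ext P _ (scons x (fun n => n))); [reflexivity|]. now intros [|n]. }
  destruct Hb as [H1 H2]. split.
  - intros v Hv Hx. destruct (H1 v Hv Hx) as [H3 H4]. split; [exact H3|]. now apply HQP.
  - intros v Hv [H3 H4]. apply (H2 v Hv). split; [exact H3|]. now apply HQP.
Qed.

Lemma upair_ex w x y : w ⊩ ∃ z, Upair z x y.
Proof.
  wex (pairing_ax w x y) as z H. wx z. split; [|split].
  - wa H. apply or_l, peq_refl.
  - wa H. apply or_r, peq_refl.
  - wi u Hu. wa H. exact Hu.
Qed.

Lemma upair_uniq w z z' x y : (w ⊩ Upair z x y) -> (w ⊩ Upair z' x y) -> w ⊩ z ≐ z'.
Proof.
  intros (H1 & H2 & H3) (H1' & H2' & H3'). apply ext. wi u. split.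
  - wi Hu. wor (imp_e (H3 u) Hu) as E | E; ws E; assumption.
  - wi Hu. wor (imp_e (H3' u) Hu) as E | E; ws E; assumption.
Qed.

Lemma pair_ex w x y : w ⊩ ∃ p, Pair p x y.
Proof.
  wex (upair_ex w x x) as a Ha. wex (upair_ex w x y) as b Hb. wex (upair_ex w a b) as p Hp.
  destruct Hp as (H1 & H2 & H3). wx p. split; [|split].
  - wx a. now split.
  - wx b. now split.
  - wi z Hz. wor (imp_e (H3 z) Hz) as E | E; ws E; [apply or_l|apply or_r]; assumption.
Qed.

Lemma pair_uniq w p q x y : (w ⊩ Pair p x y) -> (w ⊩ Pair q x y) -> w ⊩ p ≐ q.
Proof.
  assert (L : forall w p q, (w ⊩ Pair p x y) -> (w ⊩ Pair q x y) -> w ⊩ Sub p q).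
  { clear. intros w p q (H1 & H2 & H3) (H1' & H2' & H3') . wi z Hz.
    wor (imp_e (H3 z) Hz) as E | E.
    - wex H1' as z' [Hz' E']. pose proof (upair_uniq _ _ _ _ _ E E') as F. ws F. assumption.
    - wex H2' as z' [Hz' E']. pose proof (upair_uniq _ _ _ _ _ E E') as F. ws F. assumption. }
  intros H H'. apply ext. wi z. split; wi Hz.
  - exact (imp_e (L _ _ _ H H' z) Hz).
  - exact (imp_e (L _ _ _ H' H z) Hz).
Qed.

(** [L1]: the member {x} of [p] is {x'} or {x', y'}, so x' ∈ {x}. [L2]: with a common first
    component x, the member {x, y} is {x} or {x, y'}. *)
Lemma pair_inj w p x y x' y' :
  (w ⊩ Pair p x y) -> (w ⊩ Pair p x' y') -> w ⊩ x ≐ x' ∧ y ≐ y'.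
Proof.
  assert (L1 : forall w p x y x' y', (w ⊩ Pair p x y) -> (w ⊩ Pair p x' y') -> w ⊩ x' ≐ x).
  { clear. intros w p x y x' y' (H1 & H2 & H3) (H1' & H2' & H3').
    wex H1 as z [Hz (E1 & E2 & E3)].
    wor (imp_e (H3' z) Hz) as (E1' & E2' & E3') | (E1' & E2' & E3').
    - wor (imp_e (E3 x') E1') as E|E; exact E.
    - wor (imp_e (E3 x') E1') as E|E; exact E. }
  assert (L2 : forall w p x y y', (w ⊩ Pair p x y) -> (w ⊩ Pair p x y') -> w ⊩ y ≐ x ∨ y ≐ y').
  { clear. intros w p x y y' (H1 & H2 & H3) (H1' & H2' & H3').
    wex H2 as z [Hz (E1 & E2 & E3)].
    wor (imp_e (H3' z) Hz) as (E1' & E2' & E3') | (E1' & E2' & E3').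
    - wor (imp_e (E3' y) E2) as E|E; apply or_l; exact E.
    - exact (imp_e (E3' y) E2). }
  intros H H'. pose proof (L1 _ _ _ _ _ _ H H') as E. ws E. split; [apply peq_refl|].
  (* If y = x, exchanging the roles gives y' = x or y' = y, and both imply y = y'. *)
  wor (L2 _ _ _ _ _ H H') as E | E; [|exact E].
  wor (L2 _ _ _ _ _ H' H) as F | F; [|exact (peq_sym _ _ _ F)].
  exact (peq_trans _ _ _ _ E (peq_sym _ _ _ F)).
Qed.

Lemma bin_union w a b : w ⊩ ∃ c, ∀ x, x ∈ c ↔ x ∈ a ∨ x ∈ b.
Proof.
  wex (upair_ex w a b) as z (H1 & H2 & H3). wex (union_ax w z) as c H. wx c. wi x. split.
  - wi Hx. wex (imp_e (proj1 (H x)) Hx) as y [Hy Hxy].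
    wor (imp_e (H3 y) Hy) as E|E; rew E in Hxy; [now apply or_l|now apply or_r].
  - wi Hx. wa H. wor Hx as Hx|Hx; [wx a|wx b]; now split.
Qed.

Lemma singleton_ex w a : w ⊩ ∃ c, ∀ x, x ∈ c ↔ x ≐ a.
Proof.
  wex (pairing_ax w a a) as c H. wx c. wi x. split.
  - wi Hx. wor (imp_e (proj1 (H x)) Hx) as E|E; exact E.
  - wi Hx. wa H. now apply or_l.
Qed.

(** By Kuratowski's coding the double power set of A ∪ B contains all pairs; such a superset of the
    product suffices to bound separations and power sets. *)
Lemma prod_ex w A B : w ⊩ ∃ P, ∀[A] x, ∀[B] y, ∀ p, Pair p x y → p ∈ P.
Proof.
  wex (bin_union w A B) as C HC. wex (powerset_ax w C) as D HD. wex (powerset_ax w D) as P HP.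
  wx P. wi x Hx y Hy p (H1 & H2 & H3). wa HP. wi z Hz. wa HD. wi u Hu.
  wor (imp_e (H3 z) Hz) as (E1 & E2 & E) | (E1 & E2 & E); wor (imp_e (E u) Hu) as F|F; ws F;
    wa HC; (now apply or_l) || (now apply or_r).
Qed.

Lemma rel_ex (Q : nat -> nat -> prop) (HQ : Bd2 Q) w A B :
  w ⊩ ∃ r, (∀[r] p, ∃[A] x, ∃[B] y, Pair p x y) ∧ ∀[A] x, ∀[B] y, Rel r x y ↔ Q x y.
Proof.
  wex (prod_ex w A B) as P HP.
  wex (sep (fun p => ∃[A] x, ∃[B] y, Pair p x y ∧ Q x y) w P ltac:(bd)) as r Hr.
  wx r. split.
  - wi p Hp. wex (proj2 (imp_e (proj1 (Hr p)) Hp)) as x [Hx H].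
    wex H as y [Hy [H1 H2]]. wx x. split; auto. wx y. now split.
  - wi x Hx y Hy. split.
    + wi H. wex H as p [Hp H]. wex (proj2 (imp_e (proj1 (Hr p)) Hp)) as x' [Hx' H'].
      wex H' as y' [Hy' [H1 H2]]. destruct (pair_inj _ _ _ _ _ _ H H1) as [E F].
      rew E. rew F. exact H2.
    + wi H. wex (pair_ex w x y) as p Hp. wx p. split; [|exact Hp]. wa Hr. split.
      * wa HP; eassumption.
      * wx x. split; auto. wx y. split; auto. now split.
Qed.

Lemma rel_dom w f A B x y : (w ⊩ Fun f A B) -> (w ⊩ Rel f x y) -> w ⊩ x ∈ A ∧ y ∈ B.
Proof.
  intros [H _] Hxy. wex Hxy as p [Hp Hp']. wex (imp_e (H p) Hp) as x' [Hx' H'].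
  wex H' as y' [Hy' H']. destruct (pair_inj _ _ _ _ _ _ Hp' H') as [E F].
  rew E. rew F. now split.
Qed.

Lemma fun_val w f A B x : (w ⊩ Fun f A B) -> (w ⊩ x ∈ A) -> w ⊩ ∃[B] y, Rel f x y.
Proof.
  intros [_ H] Hx. wex (imp_e (H x) Hx) as y [Hy [H1 _]]. wx y. now split.
Qed.

Lemma fun_uniq w f A B x y y' :
  (w ⊩ Fun f A B) -> (w ⊩ Rel f x y) -> (w ⊩ Rel f x y') -> w ⊩ y ≐ y'.
Proof.
  intros Hf H1 H2. destruct (rel_dom _ _ _ _ _ _ Hf H1) as [Hx Hy].
  destruct (rel_dom _ _ _ _ _ _ Hf H2) as [_ Hy']. destruct Hf as [_ H].
  wex (imp_e (H x) Hx) as z [Hz [Hxz Hu]].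
  pose proof (imp_e (imp_e (Hu y) Hy) H1) as E.
  pose proof (imp_e (imp_e (Hu y') Hy') H2) as E'.
  exact (peq_trans _ _ _ _ E (peq_sym _ _ _ E')).
Qed.

Lemma inj_uniq w f A B x x' y :
  (w ⊩ Inj f A B) -> (w ⊩ Rel f x y) -> (w ⊩ Rel f x' y) -> w ⊩ x ≐ x'.
Proof.
  intros [Hf Hi] H1 H2. destruct (rel_dom _ _ _ _ _ _ Hf H1) as [Hx Hy].
  destruct (rel_dom _ _ _ _ _ _ Hf H2) as [Hx' _].
  wa Hi; eassumption.
Qed.

Lemma fun_ex (Q : nat -> nat -> prop) (HQ : Bd2 Q) w A B :
  (w ⊩ ∀[A] x, ∃[B] y, Q x y ∧ ∀[B] y', Q x y' → y' ≐ y) ->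
  w ⊩ ∃ f, Fun f A B ∧ ∀[A] x, ∀[B] y, Rel f x y ↔ Q x y.
Proof.
  intros H. wex (rel_ex Q HQ w A B) as f [H1 H2]. wx f. split; [split|]; auto.
  wi x Hx. wex (imp_e (H x) Hx) as y [Hy [H3 H4]]. wx y. split; auto. split.
  - wa H2; eassumption.
  - wi y' Hy' H5. wa H4; auto. wa H2; eassumption.
Qed.

Lemma fun_ext w f g A B :
  (w ⊩ Fun f A B) -> (w ⊩ Fun g A B) ->
  (w ⊩ ∀[A] x, ∀[B] y, Rel f x y ↔ Rel g x y) -> w ⊩ f ≐ g.
Proof.
  assert (L : forall w f g, (w ⊩ Fun f A B) ->
     (w ⊩ ∀[A] x, ∀[B] y, Rel f x y → Rel g x y) -> w ⊩ Sub f g).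
  { clear. intros w f g [Hf _] H. wi p Hp. wex (imp_e (Hf p) Hp) as x [Hx H1].
    wex H1 as y [Hy H1].
    assert (K : w ⊩ Rel g x y).
    { wa H; auto. wx p. now split. }
    wex K as q [Hq K]. pose proof (pair_uniq _ _ _ _ _ H1 K) as E. rew E. exact Hq. }
  intros Hf Hg H. apply ext. wi p. split; wi Hp.
  - refine (imp_e (L w f g Hf _ p) Hp). wi x Hx y Hy Hxy. wa H; eassumption.
  - refine (imp_e (L w g f Hg _ p) Hp). wi x Hx y Hy Hxy. wa H; eassumption.
Qed.

Lemma fun_set_ex w A B : w ⊩ ∃ E, FunSet E A B.
Proof.
  wex (prod_ex w B A) as P HP. wex (powerset_ax w P) as PP HPP.
  wex (sep (fun f => Fun f B A) w PP ltac:(bd)) as E HE. wx E. wi f. split.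
  - wi Hf. wa HE. eassumption.
  - wi Hf. wa HE. split; auto. wa HPP. wi p Hp.
    wex (imp_e (proj1 Hf p) Hp) as x [Hx H]. wex H as y [Hy H]. wa HP; eassumption.
Qed.

(** * Natural numbers *)

(** Separation turns [Q] into an inductive subset of [N], which is why [Q] has to be definable by a
    bounded formula. *)
Lemma nat_ind (Q : nat -> prop) (HQ : Bd1 Q) w N : (w ⊩ NatSet N) ->
  (w ⊩ ∀[N] z, Empty z → Q z) -> (w ⊩ ∀[N] n m, Succ m n → Q n → Q m) -> w ⊩ ∀[N] n, Q n.
Proof.
  intros [[H0 HS] Hmin] Q0 QS. wi n Hn. wex (sep Q w N HQ) as i Hi.
  refine (proj2 (imp_e (proj1 (Hi n)) _)). wa Hmin; [|exact Hn]. split.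
  - wex H0 as z [Hz Ez]. wx z. split; auto. wa Hi. split; auto. wa Q0; auto.
  - wi k Hk. destruct (imp_e (proj1 (Hi k)) Hk) as [Hk1 Hk2].
    wex (imp_e (HS k) Hk1) as m [Hm Sm]. wx m. split; auto. wa Hi. split; auto.
    wa QS; [exact Hk1|..]; eassumption.
Qed.

Lemma empty_uniq w z z' : (w ⊩ Empty z) -> (w ⊩ Empty z') -> w ⊩ z ≐ z'.
Proof.
  intros H H'. apply ext. wi x. split; wi Hx; apply bot_e; [wa H|wa H']; eassumption.
Qed.

Lemma succ_uniq w n m m' : (w ⊩ Succ m n) -> (w ⊩ Succ m' n) -> w ⊩ m ≐ m'.
Proof.
  intros (H1 & H2 & H3) (H1' & H2' & H3'). apply ext. wi x. split.
  - wi Hx. wor (imp_e (H3 x) Hx) as E|E; [wa H2'; exact E|rew E; exact H1'].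
  - wi Hx. wor (imp_e (H3' x) Hx) as E|E; [wa H2; exact E|rew E; exact H1].
Qed.

Lemma zero_ex w N : (w ⊩ NatSet N) -> w ⊩ ∃[N] z, Empty z.
Proof. intros H. apply H. Qed.

Lemma succ_ex w N n : (w ⊩ NatSet N) -> (w ⊩ n ∈ N) -> w ⊩ ∃[N] m, Succ m n.
Proof. intros H Hn. exact (imp_e (proj2 (proj1 H) n) Hn). Qed.

Lemma succ_nonempty w n m P : (w ⊩ Succ m n) -> (w ⊩ Empty m) -> w ⊩ P.
Proof. intros (H & _) E. apply bot_e. wa E. exact H. Qed.

Lemma nat_transitive w N : (w ⊩ NatSet N) -> w ⊩ ∀[N] n, ∀[n] k, Sub k n.
Proof.
  intros HN. refine (nat_ind (fun n => ∀[n] k, Sub k n) _ w N HN _ _); [bd|..].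
  - wi z Hz E k Hk. apply bot_e. wa E. exact Hk.
  - wi n Hn m Hm. wi (H1 & H2 & H3) IH k Hk u Hu.
    wor (imp_e (H3 k) Hk) as E|E.
    + wa H2. wa IH; eassumption.
    + rew E in Hu. wa H2. exact Hu.
Qed.

Lemma nat_irrefl w N : (w ⊩ NatSet N) -> w ⊩ ∀[N] n, ¬ n ∈ n.
Proof.
  intros HN. pose proof (nat_transitive w N HN) as T.
  refine (nat_ind (fun n => ¬ n ∈ n) _ w N HN _ _); [bd|..].
  - wi z Hz E H. wa E. exact H.
  - wi n Hn m Hm. wi (H1 & H2 & H3) IH H. wa IH.
    wor (imp_e (H3 m) H) as E|E.
    + wa T; eassumption.
    + rew E in H1. exact H1.
Qed.

(** If n and n' differed, each would be an element of the other, against transitivity and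
    irreflexivity of membership on [N]. *)
Lemma succ_inj w N n n' m : (w ⊩ NatSet N) -> (w ⊩ n ∈ N) -> (w ⊩ n' ∈ N) ->
  (w ⊩ Succ m n) -> (w ⊩ Succ m n') -> w ⊩ n ≐ n'.
Proof.
  intros HN Hn Hn' (H1 & H2 & H3) (H1' & H2' & H3').
  wor (imp_e (H3' n) H1) as E|E; [|exact E].
  wor (imp_e (H3 n') H1') as F|F; [|apply peq_sym, F].
  apply bot_e. wa (nat_irrefl w N HN); [exact Hn|]. wa (nat_transitive w N HN); eassumption.
Qed.

Lemma zero_le w N z : (w ⊩ NatSet N) -> (w ⊩ Empty z) -> w ⊩ ∀[N] n, z ≐ n ∨ z ∈ n.
Proof.
  intros HN E. refine (nat_ind (fun n => z ≐ n ∨ z ∈ n) _ w N HN _ _); [bd|..].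
  - wi z' Hz' E'. apply or_l. now apply empty_uniq.
  - wi n Hn m Hm. wi (H1 & H2 & H3) IH. apply or_r. wor IH as F|F.
    + rew F. exact H1.
    + wa H2. exact F.
Qed.

Lemma succ_le w N n n' : (w ⊩ NatSet N) -> (w ⊩ Succ n' n) ->
  w ⊩ ∀[N] m, n ∈ m → n' ∈ m ∨ n' ≐ m.
Proof.
  intros HN HS. refine (nat_ind (fun m => n ∈ m → n' ∈ m ∨ n' ≐ m) _ w N HN _ _); [bd|..].
  - wi z Hz E H. apply bot_e. wa E. exact H.
  - wi m Hm m' Hm'. wi (H1 & H2 & H3) IH H. wor (imp_e (H3 n) H) as E|E.
    + apply or_l. wor (imp_e IH E) as F|F; [wa H2; exact F|rew F; exact H1].
    + apply or_r. rew E in HS. apply (succ_uniq _ m); auto. split; [|split]; auto.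
Qed.

(** Induction on n, with [zero_le] and [succ_le] for the two steps. This is the constructive source
    of decidable equality on [N], and it allows two stages of a construction to be compared. *)
Lemma trichotomy w N : (w ⊩ NatSet N) -> w ⊩ ∀[N] n, ∀[N] m, n ∈ m ∨ n ≐ m ∨ m ∈ n.
Proof.
  intros HN. refine (nat_ind (fun n => ∀[N] m, n ∈ m ∨ n ≐ m ∨ m ∈ n) _ w N HN _ _); [bd|..].
  - wi z Hz E m Hm. wor (imp_e (zero_le w N z HN E m) Hm) as F|F.
    + now apply or_r, or_l.
    + now apply or_l.
  - wi n Hn n' Hn' S IH m Hm. wor (imp_e (IH m) Hm) as F|F; [|wor F as F|F].
    + wor (imp_e (imp_e (succ_le w N n n' HN S m) Hm) F) as G|G; [now apply or_l|now apply or_r, or_l].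
    + apply or_r, or_r. rew (peq_sym _ _ _ F). exact (proj1 S).
    + apply or_r, or_r. wa S. exact F.
Qed.

Lemma nat_eq_dec w N n m : (w ⊩ NatSet N) -> (w ⊩ n ∈ N) -> (w ⊩ m ∈ N) ->
  w ⊩ n ≐ m ∨ ¬ n ≐ m.
Proof.
  intros HN Hn Hm. pose proof (nat_irrefl w N HN m) as I.
  wor (imp_e (imp_e (trichotomy w N HN n) Hn m) Hm) as F|F; [|wor F as F|F].
  - apply or_r. wi E. rew E in F. wa I; assumption.
  - now apply or_l.
  - apply or_r. wi E. rew E in F. wa I; assumption.
Qed.

(** * Definition of sequences by recursion *)

Section Recursion.

Variables (Q : nat -> nat -> nat -> prop) (N X x0 : nat).
Hypothesis HQ : Bd3 Q.

Definition Closed (R : nat -> nat -> prop) : prop :=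
  (∀[N] z, Empty z → R z x0) ∧
  ∀[N] n m, Succ m n → ∀[X] s s', R n s → Q n s s' → R m s'.

(** The graph of the recursive sequence is the intersection of all closed relations. [PP] stands for
    the power set of a set containing all pairs, so that this impredicative quantifier is
    bounded. *)
Definition Least (PP n s : nat) : prop := ∀[PP] c, Closed (Rel c) → Rel c n s.

Lemma Bd_Least PP : Bd2 (Least PP).
Proof. unfold Least, Closed. bd. Qed.

Definition Functional : prop :=
  ∀[N] n, ∀[X] s, ∃[X] s', Q n s s' ∧ ∀[X] s'', Q n s s'' → s'' ≐ s'.

Lemma least_closed w PP : w ⊩ Closed (Least PP).
Proof.
  split.
  - wi z Hz E c Hc H. wa H; assumption.
  - wi n Hn m Hm S. wi s Hs s' Hs' Gs. wi Qs c Hc H.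
    wa (proj2 H); [exact Hn|exact Hm|exact S|exact Hs|exact Hs'| |exact Qs]. wa Gs; assumption.
Qed.

(** The graph of [R] on [N] and [X] is a set by separation, so it is one of the relations that are
    intersected. *)
Lemma least_ind w P PP (R : nat -> nat -> prop) : Bd2 R -> (w ⊩ x0 ∈ X) ->
  (w ⊩ ∀[N] x, ∀[X] y, ∀ p, Pair p x y → p ∈ P) -> (w ⊩ ∀ c, c ∈ PP ↔ Sub c P) ->
  (w ⊩ Closed R) -> w ⊩ ∀[N] n, ∀[X] s, Least PP n s → R n s.
Proof.
  intros HR Hx0 HP HPP C. wi n Hn s Hs Gs. wex (rel_ex R HR w N X) as c [Hc1 Hc2].
  wa Hc2; [assumption..|]. wa Gs.
  - wa HPP. wi p Hp. wex (imp_e (Hc1 p) Hp) as x [Hx H]. wex H as y [Hy H]. wa HP; eassumption.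
  - split.
    + wi z Hz E. wa Hc2; [assumption..|]. wa C; assumption.
    + wi k Hk m Hm S. wi u Hu u' Hu' Hr Hq. wa Hc2; [assumption..|].
      wa (proj2 C); [exact Hk|exact Hm|exact S|exact Hu|exact Hu'| |exact Hq].
      wa Hc2; assumption.
Qed.

Lemma least_total w PP : (w ⊩ NatSet N) -> (w ⊩ x0 ∈ X) -> (w ⊩ Functional) ->
  w ⊩ ∀[N] n, ∃[X] s, Least PP n s.
Proof.
  intros HN Hx0 HT. pose proof (Bd_Least PP) as BG. pose proof (least_closed w PP) as [G0 GS].
  refine (nat_ind (fun n => ∃[X] s, Least PP n s) _ w N HN _ _); [bd|..].
  - wi z Hz E. wx x0. split; [assumption|]. wa G0; assumption.
  - wi n Hn m Hm S IH. wex IH as s [Hs Gs].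
    wex (imp_e (imp_e (HT n) Hn s) Hs) as s' [Hs' [Qs _]].
    wx s'. split; [assumption|]. wa GS; [exact Hn|exact Hm|exact S|exact Hs|..]; eassumption.
Qed.

Lemma least_unique w P PP :
  (w ⊩ ∀[N] x, ∀[X] y, ∀ p, Pair p x y → p ∈ P) -> (w ⊩ ∀ c, c ∈ PP ↔ Sub c P) ->
  (w ⊩ NatSet N) -> (w ⊩ x0 ∈ X) -> (w ⊩ Functional) ->
  w ⊩ ∀[N] n, ∀[X] s s', Least PP n s → Least PP n s' → s ≐ s'.
Proof.
  intros HP HPP HN Hx0 HT. pose proof (Bd_Least PP) as BG.
  pose proof (least_total w PP HN Hx0 HT) as Gtot.
  refine (nat_ind (fun n => ∀[X] s s', Least PP n s → Least PP n s' → s ≐ s') _ w N HN _ _); [bd|..].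
  (* The relation that allows only [x0] at 0 and everything elsewhere is closed. *)
  - assert (C : w ⊩ Closed (fun n s => Empty n → s ≐ x0)).
    { split.
      - wi z Hz E F. apply peq_refl.
      - wi n Hn m Hm S. wi s Hs s' Hs' H. wi _ E. eapply succ_nonempty; eassumption. }
    pose proof (least_ind w P PP (fun n s => Empty n → s ≐ x0) ltac:(bd) Hx0 HP HPP C) as M.
    wi z Hz E. wi s Hs s' Hs' K K'.
    assert (E1 : w ⊩ s ≐ x0) by (wa M; [exact Hz|..]; assumption).
    assert (E2 : w ⊩ s' ≐ x0) by (wa M; [exact Hz|..]; assumption).
    exact (peq_trans _ _ _ _ E1 (peq_sym _ _ _ E2)).
  - wi n Hn m Hm S IH. wex (imp_e (Gtot n) Hn) as sn [Hsn Gsn].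
    wex (imp_e (imp_e (HT n) Hn sn) Hsn) as v [Hv [Qv Uv]].
    (* At m the least relation is pruned to the values that follow [sn]. It stays closed because the
       predecessor n of m and the value [sn] at n are unique. *)
    set (R := fun k s => Least PP k s ∧ (k ≐ m → Q n sn s)).
    assert (BR : Bd2 R) by (unfold R; bd).
    pose proof (least_closed w PP) as [G0 GS].
    assert (C : w ⊩ Closed R).
    { split.
      - wi z Hz E. split; [wa G0; assumption|]. wi F. rew F in E.
        eapply succ_nonempty; eassumption.
      - wi k Hk k' Hk' S'. wi s Hs s' Hs' [Gs _] Qs. split.
        + wa GS; [exact Hk|exact Hk'|exact S'|exact Hs|..]; eassumption.
        + wi F. rew F in S'. pose proof (succ_inj _ _ _ _ _ HN Hk Hn S' S) as E.
          rew E in Gs. rew E in Qs.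
          assert (E' : w ⊩ s ≐ sn) by (wa IH; assumption).
          rew E' in Qs. exact Qs. }
    pose proof (least_ind w P PP R BR Hx0 HP HPP C) as M.
    wi s Hs s' Hs' K K'.
    assert (E1 : w ⊩ s ≐ v).
    { wa Uv; [exact Hs|]. wa (proj2 (imp_e (imp_e (imp_e (M m) Hm s) Hs) K)). apply peq_refl. }
    assert (E2 : w ⊩ s' ≐ v).
    { wa Uv; [exact Hs'|]. wa (proj2 (imp_e (imp_e (imp_e (M m) Hm s') Hs') K')). apply peq_refl. }
    exact (peq_trans _ _ _ _ E1 (peq_sym _ _ _ E2)).
Qed.

(** The step is a functional relation rather than a set of pairs, so it can be both a map [k] and
    the matching step [Step]. *)
Lemma recursion w : (w ⊩ NatSet N) -> (w ⊩ x0 ∈ X) -> (w ⊩ Functional) ->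
  w ⊩ ∃ t, Fun t N X ∧ (∀[N] z, Empty z → Rel t z x0) ∧
    ∀[N] n m, Succ m n → ∀[X] s s', Rel t n s → Rel t m s' → Q n s s'.
Proof.
  intros HN Hx0 HT.
  wex (prod_ex w N X) as P HP. wex (powerset_ax w P) as PP HPP.
  pose proof (Bd_Least PP) as BG. pose proof (least_closed w PP) as [G0 GS].
  pose proof (least_total w PP HN Hx0 HT) as Gtot.
  pose proof (least_unique w P PP HP HPP HN Hx0 HT) as Guniq.
  assert (F : w ⊩ ∀[N] n, ∃[X] s, Least PP n s ∧ ∀[X] s', Least PP n s' → s' ≐ s).
  { wi n Hn. wex (imp_e (Gtot n) Hn) as s [Hs Gs]. wx s. split; [assumption|].
    split; [assumption|]. wi s' Hs' Gs'. wa Guniq; [exact Hn|..]; assumption. }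
  wex (fun_ex _ BG w N X F) as t [Ht1 Ht2]. wx t. split; [|split]; [assumption|..].
  - wi z Hz E. refine (imp_e (proj2 (imp_e (imp_e (Ht2 z) Hz x0) Hx0)) _). wa G0; assumption.
  - wi n Hn m Hm S. wi s Hs s' Hs' K K'.
    pose proof (imp_e (proj1 (imp_e (imp_e (Ht2 n) Hn s) Hs)) K) as Gs.
    pose proof (imp_e (proj1 (imp_e (imp_e (Ht2 m) Hm s') Hs')) K') as Gs'.
    wex (imp_e (imp_e (HT n) Hn s) Hs) as v [Hv [Qv Uv]].
    assert (E : w ⊩ s' ≐ v).
    { wa Guniq; [exact Hm|..]; [assumption..|].
      wa GS; [exact Hn|exact Hm|exact S|exact Hs|..]; eassumption. }
    rew E. exact Qv.
Qed.

End Recursion.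

(** * Chains of a pair of injections *)

Lemma comp_ex w f g X : (w ⊩ Fun f X X) -> (w ⊩ Fun g X X) ->
  w ⊩ ∃ k, Comp k g f X ∧ ∀[X] x z, Rel k x z → ∃[X] y, Rel f x y ∧ Rel g y z.
Proof.
  intros Hf Hg.
  assert (F : w ⊩ ∀[X] x, ∃[X] z, (∃[X] y, Rel f x y ∧ Rel g y z) ∧
              ∀[X] z', (∃[X] y, Rel f x y ∧ Rel g y z') → z' ≐ z).
  { wi x Hx. wex (fun_val _ _ _ _ _ Hf Hx) as y [Hy Hxy].
    wex (fun_val _ _ _ _ _ Hg Hy) as z [Hz Hyz]. wx z. split; [assumption|]. split.
    - wx y. now repeat split.
    - wi z' Hz' H. wex H as y' [Hy' [H1 H2]].
      pose proof (fun_uniq _ _ _ _ _ _ _ Hf Hxy H1) as E. rew E in Hyz.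
      exact (fun_uniq _ _ _ _ _ _ _ Hg H2 Hyz). }
  wex (fun_ex (fun x z => ∃[X] y, Rel f x y ∧ Rel g y z) ltac:(bd) w X X F) as k [Hk1 Hk2].
  wx k. split; [split; [assumption|]|].
  - wi x Hx y Hy z Hz H1. wi H2. wa Hk2; [assumption..|]. wx y. now repeat split.
  - wi x Hx z Hz H. exact (imp_e (proj1 (imp_e (imp_e (Hk2 x) Hx z) Hz)) H).
Qed.

(** The reflexive transitive closure of [k], as membership in all subsets of [X] closed under [k].
    With [PX] the power set of [X] it is bounded and involves no iteration count. *)
Definition Reach (X PX k x y : nat) : prop :=
  ∀[PX] c, x ∈ c → (∀[c] u, ∀[X] v, Rel k u v → v ∈ c) → y ∈ c.

Lemma Bd_Reach j X PX k x y : Term j X -> Term j PX -> Term j k -> Term j x -> Term j y ->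
  Bd j (fun v => Reach (X v) (PX v) (k v) (x v) (y v)).
Proof. intros. unfold Reach. bd. Qed.
#[local] Hint Resolve Bd_Reach : bd.

Section Reach.

Variables (X PX k : nat).

Lemma reach_ind (Q : nat -> prop) (HQ : Bd1 Q) w x :
  (w ⊩ ∀ c, c ∈ PX ↔ Sub c X) -> (w ⊩ x ∈ X) -> (w ⊩ Q x) ->
  (w ⊩ ∀[X] u v, Rel k u v → Q u → Q v) -> w ⊩ ∀ y, Reach X PX k x y → y ∈ X ∧ Q y.
Proof.
  intros HP Hx H0 HS. wex (sep Q w X HQ) as c Hc. wi y H.
  refine (imp_e (proj1 (Hc y)) _). wa H.
  - wa HP. wi u Hu. exact (proj1 (imp_e (proj1 (Hc u)) Hu)).
  - wa Hc. now split.
  - wi u Hu v Hv Huv. destruct (imp_e (proj1 (Hc u)) Hu) as [Hu1 Hu2].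
    wa Hc. split; [assumption|]. wa HS; [exact Hu1|..]; eassumption.
Qed.

Lemma reach_refl w x : w ⊩ Reach X PX k x x.
Proof. wi c Hc H _. exact H. Qed.

Lemma reach_step w x u v : (w ⊩ Fun k X X) ->
  (w ⊩ Reach X PX k x u) -> (w ⊩ Rel k u v) -> w ⊩ Reach X PX k x v.
Proof.
  intros Hk H Huv. destruct (rel_dom _ _ _ _ _ _ Hk Huv) as [Hu Hv].
  wi c Hc H1 H2. wa H2; [|exact Hv|exact Huv]. wa H; eassumption.
Qed.

Lemma reach_trans w x y z :
  (w ⊩ Reach X PX k x y) -> (w ⊩ Reach X PX k y z) -> w ⊩ Reach X PX k x z.
Proof.
  intros H H'. wi c Hc H1 H2. wa H'; [assumption| |assumption]. wa H; assumption.
Qed.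

Lemma reach_last w x y : (w ⊩ ∀ c, c ∈ PX ↔ Sub c X) -> (w ⊩ Fun k X X) -> (w ⊩ x ∈ X) ->
  (w ⊩ Reach X PX k x y) -> w ⊩ y ≐ x ∨ ∃[X] u, Reach X PX k x u ∧ Rel k u y.
Proof.
  intros HP Hk Hx H.
  refine (proj2 (proj2 (imp_e (reach_ind
    (fun y => Reach X PX k x y ∧ (y ≐ x ∨ ∃[X] u, Reach X PX k x u ∧ Rel k u y))
    _ w x HP Hx _ _ y) H))); [bd|..].
  - split; [apply reach_refl|]. apply or_l, peq_refl.
  - wi u Hu v Hv Huv. wi [H1 _]. split.
    + eapply reach_step; eassumption.
    + apply or_r. wx u. now repeat split.
Qed.

Lemma reach_first w x y : (w ⊩ ∀ c, c ∈ PX ↔ Sub c X) -> (w ⊩ Fun k X X) -> (w ⊩ x ∈ X) ->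
  (w ⊩ Reach X PX k x y) -> w ⊩ y ≐ x ∨ ∃[X] u, Rel k x u ∧ Reach X PX k u y.
Proof.
  intros HP Hk Hx H.
  refine (proj2 (imp_e (reach_ind
    (fun y => y ≐ x ∨ ∃[X] u, Rel k x u ∧ Reach X PX k u y)
    _ w x HP Hx _ _ y) H)); [bd|..].
  - apply or_l, peq_refl.
  - wi u Hu v Hv Huv. wi IH. apply or_r. wor IH as E|IH.
    + rew E in Huv. wx v. split; [assumption|]. split; [assumption|apply reach_refl].
    + wex IH as a [Ha [H1 H2]]. wx a. split; [assumption|]. split; [assumption|].
      eapply reach_step; eassumption.
Qed.

(** For injective [k] this is the equivalence relation of sharing an orbit, since the orbits of an
    injection neither merge nor branch. *)
Definition Linked x y : prop := Reach X PX k x y ∨ Reach X PX k y x.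

(** Induction along the path from x to y. If z arrives at the next point by a last step, injectivity
    makes this step start at the current point; otherwise z is the next point itself. *)
Lemma linked_target w x y z : (w ⊩ ∀ c, c ∈ PX ↔ Sub c X) -> (w ⊩ Inj k X X) ->
  (w ⊩ x ∈ X) -> (w ⊩ z ∈ X) ->
  (w ⊩ Reach X PX k x y) -> (w ⊩ Reach X PX k z y) -> w ⊩ Linked x z.
Proof.
  intros HP Hk Hx Hz H. apply imp_e. unfold Linked.
  refine (proj2 (proj2 (imp_e (reach_ind
    (fun y => Reach X PX k x y ∧ (Reach X PX k z y → Reach X PX k x z ∨ Reach X PX k z x))
    _ w x HP Hx _ _ y) H))); [bd|..].
  - split; [apply reach_refl|]. wi H'. now apply or_r.
  - wi u Hu v Hv Huv. wi [H1 H2]. pose proof (reach_step _ _ _ _ (proj1 Hk) H1 Huv) as H3.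
    split; [assumption|]. wi H4.
    wor (reach_last _ _ _ HP (proj1 Hk) Hz H4) as E|E.
    + apply or_l. rew E in H3. exact H3.
    + wex E as u' [Hu' [H5 H6]]. pose proof (inj_uniq _ _ _ _ _ _ _ Hk H6 Huv) as F.
      rew F in H5. wa H2. exact H5.
Qed.

(** Induction along the path from y to x. If x still reaches z, then either x = z or the first step
    towards z leads to the next point, since [k] is single-valued. *)
Lemma linked_source w x y z : (w ⊩ ∀ c, c ∈ PX ↔ Sub c X) -> (w ⊩ Fun k X X) ->
  (w ⊩ x ∈ X) -> (w ⊩ y ∈ X) ->
  (w ⊩ Reach X PX k y x) -> (w ⊩ Reach X PX k y z) -> w ⊩ Linked x z.
Proof.
  intros HP Hk Hx Hy H H'. unfold Linked.
  refine (proj2 (proj2 (imp_e (reach_ind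
    (fun x => Reach X PX k y x ∧ (Reach X PX k x z ∨ Reach X PX k z x))
    _ w y HP Hy _ _ x) H))); [bd|..].
  - split; [apply reach_refl|]. now apply or_l.
  - wi u Hu v Hv Huv. wi [H1 H2]. split; [eapply reach_step; eassumption|].
    wor H2 as H2|H2.
    + wor (reach_first _ _ _ HP Hk Hu H2) as E|E.
      * apply or_r. rew E. eapply reach_step; [eassumption|apply reach_refl|eassumption].
      * wex E as a [Ha [H3 H4]]. pose proof (fun_uniq _ _ _ _ _ _ _ Hk H3 Huv) as F.
        rew F in H4. apply or_l. exact H4.
    + apply or_r. eapply reach_step; eassumption.
Qed.

Lemma linked_sym w x y : (w ⊩ Linked x y) -> w ⊩ Linked y x.
Proof. intros H. wor H as H|H; [now apply or_r|now apply or_l]. Qed.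

Lemma linked_trans w x y z : (w ⊩ ∀ c, c ∈ PX ↔ Sub c X) -> (w ⊩ Inj k X X) ->
  (w ⊩ x ∈ X) -> (w ⊩ y ∈ X) -> (w ⊩ z ∈ X) ->
  (w ⊩ Linked x y) -> (w ⊩ Linked y z) -> w ⊩ Linked x z.
Proof.
  intros HP Hk Hx Hy Hz H H'. wor H as H|H; wor H' as H'|H'.
  - apply or_l. eapply reach_trans; eassumption.
  - exact (linked_target _ _ _ _ HP Hk Hx Hz H H').
  - exact (linked_source _ _ _ _ HP (proj1 Hk) Hx Hy H H').
  - apply or_r. eapply reach_trans; eassumption.
Qed.

(** The values of the sequence x, k x, k (k x), ... obtained by recursion are closed under [k],
    hence include every reachable point. *)
Lemma reach_iter w N x y : (w ⊩ NatSet N) ->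
  (w ⊩ ∀ c, c ∈ PX ↔ Sub c X) -> (w ⊩ Fun k X X) -> (w ⊩ x ∈ X) ->
  (w ⊩ Reach X PX k x y) -> w ⊩ ∃[N] n, Iter N X k n x y.
Proof.
  intros HN HP Hk Hx H.
  assert (F : w ⊩ Functional (fun _ => Rel k) N X).
  { wi n Hn s Hs. wex (fun_val _ _ _ _ _ Hk Hs) as s' [Hs' E]. wx s'. split; [assumption|]. split; [assumption|].
    wi s'' Hs'' E'. exact (fun_uniq _ _ _ _ _ _ _ Hk E' E). }
  wex (recursion (fun _ => Rel k) N X x ltac:(bd) w HN Hx F) as t (Ht & H0 & HS).
  wex (proj2 (imp_e (reach_ind (fun y => ∃[N] n, Rel t n y) ltac:(bd) w x HP Hx
      ltac:(wex (zero_ex _ _ HN) as z [Hz E]; wx z; split; [|wa H0]; assumption)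
      ltac:(wi u Hu v Hv Huv; wi IH; wex IH as n [Hn Hnu];
            wex (succ_ex _ _ _ HN Hn) as m [Hm S];
            wex (fun_val _ _ _ _ _ Ht Hm) as v' [Hv' Hmv];
            pose proof (imp_e (imp_e (imp_e (imp_e (imp_e (imp_e (imp_e (HS n) Hn m) Hm) S u) Hu v') Hv') Hnu) Hmv) as K;
            pose proof (fun_uniq _ _ _ _ _ _ _ Hk K Huv) as E;
            rew E in Hmv; wx m; now split) y) H)) as n [Hn Hny].
  wx n. split; [assumption|]. wx t. exact (conj Ht (conj H0 (conj HS Hny))).
Qed.

End Reach.

Lemma Bd_Linked j X PX k x y : Term j X -> Term j PX -> Term j k -> Term j x -> Term j y ->
  Bd j (fun v => Linked (X v) (PX v) (k v) (x v) (y v)).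
Proof. intros. unfold Linked. bd. Qed.
#[local] Hint Resolve Bd_Linked : bd.

(* The union of the R^{f,g}_m: x and g y lie on one orbit of k = g ∘ f. *)
Definition Chain (X PX k g x y : nat) : prop := ∃[X] v, Rel g y v ∧ Linked X PX k x v.

Lemma Bd_Chain X PX k g : Bd2 (Chain X PX k g).
Proof. unfold Chain. bd. Qed.

Definition InR N X f g x y : prop := ∃[N] n, RNonneg N X f g n x y ∨ RNeg N X f g n x y.

Lemma comp_inj w k f g X : (w ⊩ Inj f X X) -> (w ⊩ Inj g X X) -> (w ⊩ Fun k X X) ->
  (w ⊩ ∀[X] x z, Rel k x z → ∃[X] y, Rel f x y ∧ Rel g y z) -> w ⊩ Inj k X X.
Proof.
  intros Hf Hg Hk H. split; [assumption|]. wi x Hx x' Hx' y Hy H1. wi H2.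
  wex (imp_e (imp_e (imp_e (H x) Hx y) Hy) H1) as u [Hu [A1 A2]].
  wex (imp_e (imp_e (imp_e (H x') Hx' y) Hy) H2) as u' [Hu' [B1 B2]].
  pose proof (inj_uniq _ _ _ _ _ _ _ Hg A2 B2) as E. rew E in A1.
  exact (inj_uniq _ _ _ _ _ _ _ Hf A1 B1).
Qed.

Lemma chain_ex w N X f g : (w ⊩ NatSet N) -> (w ⊩ Inj f X X) -> (w ⊩ Inj g X X) ->
  w ⊩ ∃ PX k, (∀[X] x y, Rel f x y → Chain X PX k g x y) ∧
    (∀[X] x y, Rel g y x → Chain X PX k g x y) ∧
    (∀[X] x y x' y', Chain X PX k g x y → Chain X PX k g x' y → Chain X PX k g x' y' →
       Chain X PX k g x y') ∧
    (∀[X] x y, Chain X PX k g x y → InR N X f g x y).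
Proof.
  intros HN Hf Hg.
  wex (comp_ex _ _ _ _ (proj1 Hf) (proj1 Hg)) as k [Ck Dk].
  wex (comp_ex _ _ _ _ (proj1 Hg) (proj1 Hf)) as k' [Ck' Dk'].
  pose proof (comp_inj _ _ _ _ _ Hf Hg (proj1 Ck) Dk) as Hk.
  pose proof (proj1 Ck') as Hk'.
  wex (powerset_ax w X) as PX HP. wx PX. wx k. split; [|split; [|split]].
  - wi x Hx y Hy H. wex (fun_val _ _ _ _ _ (proj1 Hg) Hy) as v [Hv Hyv].
    wx v. split; [assumption|]. split; [assumption|]. apply or_l.
    eapply reach_step; [exact (proj1 Hk)|apply reach_refl|].
    exact (imp_e (imp_e (imp_e (imp_e (imp_e (proj2 Ck x) Hx y) Hy v) Hv) H) Hyv).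
  - wi x Hx y Hy H. wx x. split; [assumption|]. split; [assumption|]. apply or_l, reach_refl.
  (* Both x and x' are linked to g y, and x' is linked to g y'; transitivity links x to g y'. *)
  - wi x Hx y Hy x' Hx' y' Hy'. wi H1 H2 H3.
    wex H1 as v [Hv [A1 A2]]. wex H2 as u [Hu [B1 B2]]. wex H3 as u' [Hu' [C1 C2]].
    pose proof (fun_uniq _ _ _ _ _ _ _ (proj1 Hg) A1 B1) as E. ws E.
    wx u'. split; [assumption|]. split; [assumption|].
    apply (linked_trans X PX k w x x' u' HP Hk Hx Hx' Hu'); [|assumption].
    apply (linked_trans X PX k w x u x' HP Hk Hx Hu Hx'); [assumption|].
    apply linked_sym; assumption.
  - wi x Hx y Hy H. wex H as v [Hv [H1 H2]].
    (* If g y reaches x along g ∘ f, then x = g u with u on the forward orbit of y under f ∘ g. This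
       is the case of negative m. *)
    assert (L : w ⊩ Reach X PX k v x → InR N X f g x y).
    { wi R. wex (proj2 (imp_e (reach_ind X PX k (fun x => ∃[X] u, Reach X PX k' y u ∧ Rel g u x)
         ltac:(bd) w v HP Hv
         ltac:(wx y; split; [assumption|]; split; [apply reach_refl|assumption])
         ltac:(wi a Ha b Hb Hab; wi IH; wex IH as u [Hu [A1 A2]];
               wex (imp_e (imp_e (imp_e (Dk a) Ha b) Hb) Hab) as c [Hc [B1 B2]];
               wx c; split; [assumption|]; split; [|assumption];
               eapply reach_step; [exact Hk'|exact A1|];
               exact (imp_e (imp_e (imp_e (imp_e (imp_e (proj2 Ck' u) Hu a) Ha c) Hc) A2) B1)) x) R)) as u [Hu [A1 A2]].
      wex (reach_iter X PX k' w N y u HN HP Hk' Hy A1) as n [Hn I].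
      wx n. split; [assumption|]. apply or_r. wx k'. split; [assumption|].
      wx u. split; [assumption|]. now split. }
    wor H2 as H2|H2; [|wa L; assumption].
    (* If x reaches g y, a path of length 0 falls under [L]; otherwise its last step ends in g (f u)
       = g y, and y = f u by injectivity of g. *)
    wor (reach_last _ _ _ _ _ _ HP (proj1 Hk) Hx H2) as E|E.
    + wa L. rew E. apply reach_refl.
    + wex E as u [Hu [A1 A2]].
      wex (imp_e (imp_e (imp_e (Dk u) Hu v) Hv) A2) as c [Hc [B1 B2]].
      pose proof (inj_uniq _ _ _ _ _ _ _ Hg B2 H1) as E. rew E in B1.
      wex (reach_iter X PX k w N x u HN HP (proj1 Hk) Hx A1) as n [Hn I].
      wx n. split; [assumption|]. apply or_l. wx k. split; [assumption|].
      wx u. split; [assumption|]. now split.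
Qed.

(** [f] itself serves as the bijection, its graph being the relation R^{f,g}_m with m = 0. *)
Lemma strong_myhill_surj w N X : (w ⊩ NatSet N) ->
  (w ⊩ ∀ f, Inj f X X → ∀[X] y, ∃[X] x, Rel f x y) -> w ⊩ StrongMyhill N X.
Proof.
  intros HN H. wi f g Hf Hg. wex (chain_ex _ _ _ _ _ HN Hf Hg) as PX K.
  wex K as k (C1 & C2 & C3 & C4). wx f. split.
  - split; [assumption|]. exact (imp_e (H f) Hf).
  - wi x Hx y Hy Hxy. refine (imp_e (imp_e (imp_e (C4 x) Hx y) Hy) _).
    exact (imp_e (imp_e (imp_e (C1 x) Hx y) Hy) Hxy).
Qed.

(** * Back and forth on the natural numbers *)

Lemma rel_dec w N f x y : (w ⊩ NatSet N) -> (w ⊩ Fun f N N) -> (w ⊩ x ∈ N) -> (w ⊩ y ∈ N) ->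
  w ⊩ Rel f x y ∨ ¬ Rel f x y.
Proof.
  intros HN Hf Hx Hy. wex (fun_val _ _ _ _ _ Hf Hx) as v [Hv H].
  wor (nat_eq_dec _ _ _ _ HN Hy Hv) as E|E.
  - apply or_l. rew E. assumption.
  - apply or_r. wi H'. wa E. exact (fun_uniq _ _ _ _ _ _ _ Hf H' H).
Qed.

(* The graph of g followed by the transposition of x and g (f x). *)
Definition SwapRel (N f g x y z : nat) : prop :=
  (Rel f x y ∧ z ≐ x) ∨ (¬ Rel f x y ∧ Rel g y x ∧ ∃[N] v, Rel f x v ∧ Rel g v z) ∨
  (¬ Rel f x y ∧ ¬ Rel g y x ∧ Rel g y z).

Definition Swap (N f g x g' : nat) : prop :=
  Fun g' N N ∧ ∀[N] y z, Rel g' y z ↔ SwapRel N f g x y z.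

Lemma Bd_Swap k N f g x g' : Term k N -> Term k f -> Term k g -> Term k x -> Term k g' ->
  Bd k (fun v => Swap (N v) (f v) (g v) (x v) (g' v)).
Proof. intros. unfold Swap, SwapRel. bd. Qed.
#[local] Hint Resolve Bd_Swap : bd.

(** [C] will be the chain relation of the original pair, a fixed bound while the pair changes. The
    clauses are symmetric, so [good_flip] and [zigzag_flip] reduce backward steps to forward
    ones. *)
Definition Good (C : nat -> nat -> prop) (N f g : nat) : prop :=
  Inj f N N ∧ Inj g N N ∧ (∀[N] x y, Rel f x y → C x y) ∧ (∀[N] y x, Rel g y x → C x y).

Definition Zigzag (C : nat -> nat -> prop) (N : nat) : prop :=
  ∀[N] x y x' y', C x y → C x' y → C x' y' → C x y'.

Lemma good_flip w C N f g : (w ⊩ Good C N f g) -> w ⊩ Good (fun y x => C x y) N g f.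
Proof. intros (H1 & H2 & H3 & H4). exact (conj H2 (conj H1 (conj H4 H3))). Qed.

Lemma zigzag_flip w C N : (w ⊩ Zigzag C N) -> w ⊩ Zigzag (fun y x => C x y) N.
Proof.
  intros H. wi y Hy x Hx y' Hy' x' Hx'. wi H1 H2 H3.
  exact (imp_e (imp_e (imp_e (imp_e (imp_e (imp_e (imp_e (H x') Hx' y') Hy' x) Hx y) Hy) H3) H2) H1).
Qed.

Section Swap.

Variables (N f g x : nat).

Lemma swap_total w : (w ⊩ NatSet N) -> (w ⊩ Fun f N N) -> (w ⊩ Fun g N N) -> (w ⊩ x ∈ N) ->
  w ⊩ ∃ g', Swap N f g x g'.
Proof.
  intros HN Hf Hg Hx.
  refine (ex_e _ _ _ (fun_ex (SwapRel N f g x) _ w N N _) _); [unfold SwapRel; bd|..].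
  - wi y Hy. wor (rel_dec _ _ _ _ _ HN Hf Hx Hy) as D|D.
    + wx x. split; [assumption|]. split; [apply or_l; split; [assumption|apply peq_refl]|].
      wi z' Hz' H. wor H as [_ E]|H; [assumption|]. apply bot_e.
      wor H as (A & _)|(A & _); wa A; assumption.
    + wor (rel_dec _ _ _ _ _ HN Hg Hy Hx) as D'|D'.
      * wex (fun_val _ _ _ _ _ Hf Hx) as v [Hv Hxv]. wex (fun_val _ _ _ _ _ Hg Hv) as z [Hz Hvz].
        wx z. split; [assumption|]. split.
        { apply or_r, or_l. split; [assumption|]. split; [assumption|]. wx v. now repeat split. }
        wi z' Hz' H. wor H as (A & _)|H; [apply bot_e; wa D; assumption|].
        wor H as (_ & _ & A)|(_ & A & _); [|apply bot_e; wa A; assumption].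
        wex A as v' [Hv' [A1 A2]]. pose proof (fun_uniq _ _ _ _ _ _ _ Hf A1 Hxv) as E.
        rew E in A2. exact (fun_uniq _ _ _ _ _ _ _ Hg A2 Hvz).
      * wex (fun_val _ _ _ _ _ Hg Hy) as z [Hz Hyz]. wx z. split; [assumption|]. split.
        { apply or_r, or_r. split; [assumption|]. now split. }
        wi z' Hz' H. wor H as (A & _)|H; [apply bot_e; wa D; assumption|].
        wor H as (_ & A & _)|(_ & _ & A); [apply bot_e; wa D'; assumption|].
        exact (fun_uniq _ _ _ _ _ _ _ Hg A Hyz).
  - intros g' w' l [H1 H2]; lift l. wx g'. now split.
Qed.

Lemma swap_unique w g1 g2 : (w ⊩ Swap N f g x g1) -> (w ⊩ Swap N f g x g2) -> w ⊩ g1 ≐ g2.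
Proof.
  intros [F1 H1] [F2 H2]. apply (fun_ext _ _ _ N N); [assumption..|].
  wi y Hy z Hz. split; wi H.
  - exact (imp_e (proj2 (imp_e (imp_e (H2 y) Hy z) Hz)) (imp_e (proj1 (imp_e (imp_e (H1 y) Hy z) Hz)) H)).
  - exact (imp_e (proj2 (imp_e (imp_e (H1 y) Hy z) Hz)) (imp_e (proj1 (imp_e (imp_e (H2 y) Hy z) Hz)) H)).
Qed.

Lemma swap_hit w g' y : (w ⊩ x ∈ N) -> (w ⊩ Fun f N N) ->
  (w ⊩ Swap N f g x g') -> (w ⊩ Rel f x y) -> w ⊩ Rel g' y x.
Proof.
  intros Hx Hf [_ H] Hxy. destruct (rel_dom _ _ _ _ _ _ Hf Hxy) as [_ Hy].
  refine (imp_e (proj2 (imp_e (imp_e (H y) Hy x) Hx)) _). apply or_l. split; [assumption|apply peq_refl].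
Qed.

(** If b = f x, then a = x by injectivity of f, and x is the new value at b. Otherwise g b = x is
    impossible, as it would give a = x and f x = b; so the value at b is unchanged. *)
Lemma swap_mono w g' a b : (w ⊩ NatSet N) -> (w ⊩ x ∈ N) -> (w ⊩ Inj f N N) -> (w ⊩ Fun g N N) ->
  (w ⊩ Swap N f g x g') -> (w ⊩ Rel f a b) -> (w ⊩ Rel g b a) -> w ⊩ Rel g' b a.
Proof.
  intros HN Hx Hf Hg [_ H] Hab Hba. destruct (rel_dom _ _ _ _ _ _ Hg Hba) as [Hb Ha].
  refine (imp_e (proj2 (imp_e (imp_e (H b) Hb a) Ha)) _).
  wor (rel_dec _ _ _ _ _ HN (proj1 Hf) Hx Hb) as D|D.
  - apply or_l. split; [assumption|]. exact (inj_uniq _ _ _ _ _ _ _ Hf Hab D).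
  - apply or_r, or_r. split; [assumption|]. split; [|assumption].
    wi D'. wa D. pose proof (fun_uniq _ _ _ _ _ _ _ Hg D' Hba) as E. rew E. assumption.
Qed.

(** When the second case of [SwapRel] meets another one, z = g (f x), and injectivity of g forces an
    argument outside the first case to be f x. The first and third cases are separated by the
    condition that g y is not x. *)
Lemma swap_inj w y1 y2 z : (w ⊩ Inj f N N) -> (w ⊩ Inj g N N) ->
  (w ⊩ SwapRel N f g x y1 z) -> (w ⊩ SwapRel N f g x y2 z) -> w ⊩ y1 ≐ y2.
Proof.
  assert (L12 : forall w y1 y2, (w ⊩ Inj g N N) -> (w ⊩ Rel f x y1) -> (w ⊩ z ≐ x) ->
    (w ⊩ ¬ Rel f x y2) -> (w ⊩ Rel g y2 x) -> (w ⊩ ∃[N] v, Rel f x v ∧ Rel g v z) -> w ⊩ pbot).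
  { clear. intros w y1 y2 Hg H1 E H2 H3 H4. wex H4 as v [Hv [A1 A2]]. rew E in A2.
    pose proof (inj_uniq _ _ _ _ _ _ _ Hg A2 H3) as F. rew F in A1. wa H2. assumption. }
  assert (L23 : forall w y2, (w ⊩ Inj g N N) -> (w ⊩ ∃[N] v, Rel f x v ∧ Rel g v z) ->
    (w ⊩ ¬ Rel f x y2) -> (w ⊩ Rel g y2 z) -> w ⊩ pbot).
  { clear. intros w y2 Hg H1 H2 H3. wex H1 as v [Hv [A1 A2]].
    pose proof (inj_uniq _ _ _ _ _ _ _ Hg A2 H3) as F. rew F in A1. wa H2. assumption. }
  intros Hf Hg H1 H2.
  wor H1 as [A1 A2]|H1; [|wor H1 as (A1 & A2 & A3)|(A1 & A2 & A3)];
  (wor H2 as [B1 B2]|H2; [|wor H2 as (B1 & B2 & B3)|(B1 & B2 & B3)]).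
  - exact (fun_uniq _ _ _ _ _ _ _ (proj1 Hf) A1 B1).
  - apply bot_e, (L12 w y1 y2); assumption.
  - apply bot_e. rew A2 in B3. wa B2. assumption.
  - apply bot_e, (L12 w y2 y1); assumption.
  - exact (inj_uniq _ _ _ _ _ _ _ Hg A2 B2).
  - apply bot_e, (L23 w y2); assumption.
  - apply bot_e. rew B2 in A3. wa A2. assumption.
  - apply bot_e, (L23 w y1); assumption.
  - exact (inj_uniq _ _ _ _ _ _ _ Hg A3 B3).
Qed.

Lemma swap_good C w g' : (w ⊩ Zigzag C N) -> (w ⊩ x ∈ N) -> Bd2 C ->
  (w ⊩ Good C N f g) -> (w ⊩ Swap N f g x g') -> w ⊩ Good C N f g'.
Proof.
  intros HZ Hx HC (H1 & H2 & H3 & H4) [Fg' Hg'].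
  split; [assumption|]. split; [split; [assumption|]|split; [assumption|]].
  - wi y Hy y' Hy' z Hz H. wi H'. apply (swap_inj w y y' z); [assumption..| |].
    + exact (imp_e (proj1 (imp_e (imp_e (Hg' y) Hy z) Hz)) H).
    + exact (imp_e (proj1 (imp_e (imp_e (Hg' y') Hy' z) Hz)) H').
  - wi y Hy z Hz H. pose proof (imp_e (proj1 (imp_e (imp_e (Hg' y) Hy z) Hz)) H) as K.
    wor K as [K E]|K; [|wor K as (_ & K1 & K2)|(_ & _ & K)].
    + rew E. exact (imp_e (imp_e (imp_e (H3 x) Hx y) Hy) K).
    + wex K2 as v [Hv [A1 A2]].
      (* Here z = g v, v = f x and x = g y: three links that the zigzag property closes up. *)
      refine (imp_e (imp_e (imp_e (imp_e (imp_e (imp_e (imp_e (HZ z) Hz v) Hv x) Hx y) Hy) _) _) _).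
      * exact (imp_e (imp_e (imp_e (H4 v) Hv z) Hz) A2).
      * exact (imp_e (imp_e (imp_e (H3 x) Hx v) Hv) A1).
      * exact (imp_e (imp_e (imp_e (H4 y) Hy x) Hx) K1).
    + exact (imp_e (imp_e (imp_e (H4 y) Hy z) Hz) K).
Qed.

End Swap.

Section BackAndForth.

Variables (N F : nat) (C : nat -> nat -> prop).
Hypothesis HC : Bd2 C.

Definition State s : prop := ∃[F] f g, Pair s f g ∧ Good C N f g.
(** The first swap matches n in the left copy with f n; the second, which uses the new g', matches n
    in the right copy with g' n. *)
Definition Step n s s' : prop := ∃[F] f g f' g',
  Pair s f g ∧ Pair s' f' g' ∧ Swap N f g n g' ∧ Swap N g' f n f'.
Definition Match s a b : prop := ∃[F] f g, Pair s f g ∧ Rel f a b ∧ Rel g b a.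

Lemma Bd_State : Bd1 State.
Proof. unfold State, Good. bd. Qed.
Lemma Bd_Step : Bd3 Step.
Proof. unfold Step. bd. Qed.
Lemma Bd_Match : Bd3 Match.
Proof. unfold Match. bd. Qed.

Lemma step_ex w n s : (w ⊩ NatSet N) -> (w ⊩ FunSet F N N) -> (w ⊩ Zigzag C N) ->
  (w ⊩ n ∈ N) -> (w ⊩ State s) -> w ⊩ ∃ s', State s' ∧ Step n s s'.
Proof.
  intros HN HF HZ Hn H. wex H as f [Hf H]. wex H as g [Hg [P G]].
  pose proof G as (If & Ig & _).
  wex (swap_total _ _ _ _ _ HN (proj1 If) (proj1 Ig) Hn) as g' Sg.
  pose proof (swap_good _ _ _ _ _ _ _ HZ Hn HC G Sg) as G'.
  wex (swap_total _ _ _ _ _ HN (proj1 Sg) (proj1 If) Hn) as f' Sf.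
  (* The second swap is a first swap with the two copies of [N] exchanged. *)
  pose proof (swap_good _ _ _ _ (fun y x => C x y) _ _ (zigzag_flip _ _ _ HZ) Hn ltac:(bd)
     (good_flip _ _ _ _ _ G') Sf) as G''.
  apply good_flip in G''.
  wex (pair_ex w f' g') as s' P'. wx s'.
  assert (Hf' : w ⊩ f' ∈ F) by (exact (imp_e (proj2 (HF f')) (proj1 Sf))).
  assert (Hg' : w ⊩ g' ∈ F) by (exact (imp_e (proj2 (HF g')) (proj1 Sg))).
  split.
  - wx f'. split; [assumption|]. wx g'. split; [assumption|]. now split.
  - wx f. split; [assumption|]. wx g. split; [assumption|].
    wx f'. split; [assumption|]. wx g'. split; [assumption|].
    exact (conj P (conj P' (conj Sg Sf))).
Qed.

Lemma step_unique w n s s1 s2 : (w ⊩ Step n s s1) -> (w ⊩ Step n s s2) -> w ⊩ s1 ≐ s2.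
Proof.
  intros H1 H2.
  wex H1 as f [_ H1]. wex H1 as g [_ H1]. wex H1 as f1 [_ H1]. wex H1 as g1 [_ (P & P1 & A1 & B1)].
  wex H2 as k [_ H2]. wex H2 as j [_ H2]. wex H2 as f2 [_ H2]. wex H2 as g2 [_ (Q & P2 & A2 & B2)].
  destruct (pair_inj _ _ _ _ _ _ P Q) as [E1 E2]. ws E1. ws E2.
  pose proof (swap_unique _ _ _ _ _ _ _ A1 A2) as E. ws E.
  pose proof (swap_unique _ _ _ _ _ _ _ B1 B2) as E. ws E.
  exact (pair_uniq _ _ _ _ _ P1 P2).
Qed.

Lemma step_match w n s s' : (w ⊩ NatSet N) -> (w ⊩ n ∈ N) -> (w ⊩ State s) -> (w ⊩ State s') ->
  (w ⊩ Step n s s') ->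
  w ⊩ (∀ a b, Match s a b → Match s' a b) ∧ (∃[N] b, Match s' n b) ∧ (∃[N] a, Match s' a n).
Proof.
  intros HN Hn H H' K.
  wex K as f [Hf K]. wex K as g [Hg K]. wex K as f' [Hf' K]. wex K as g' [Hg' (P & P' & A & B)].
  wex H as k [_ H]. wex H as j [_ [Q G]]. destruct (pair_inj _ _ _ _ _ _ P Q) as [E1 E2].
  pose proof G as (If & Ig & _). rew (peq_sym _ _ _ E1) in If. rew (peq_sym _ _ _ E2) in Ig.
  wex H' as k' [_ H']. wex H' as j' [_ [Q' G']]. destruct (pair_inj _ _ _ _ _ _ P' Q') as [E1' E2'].
  pose proof G' as (If' & Ig' & _). rew (peq_sym _ _ _ E1') in If'. rew (peq_sym _ _ _ E2') in Ig'.
  clear Q Q' G G' E1 E2 E1' E2'.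
  split; [|split].
  - wi a b M. wex M as f0 [_ M]. wex M as g0 [_ (P0 & M1 & M2)].
    destruct (pair_inj _ _ _ _ _ _ P0 P) as [E1 E2]. rew E1 in M1. rew E2 in M2.
    pose proof (swap_mono _ _ _ _ _ _ _ _ HN Hn If (proj1 Ig) A M1 M2) as M3.
    wx f'. split; [assumption|]. wx g'. split; [assumption|]. split; [assumption|].
    split; [|assumption].
    exact (swap_mono _ _ _ _ _ _ _ _ HN Hn Ig' (proj1 If) B M3 M1).
  - wex (fun_val _ _ _ _ _ (proj1 If) Hn) as b [Hb M1]. wx b. split; [assumption|].
    pose proof (swap_hit _ _ _ _ _ _ _ Hn (proj1 If) A M1) as M2.
    wx f'. split; [assumption|]. wx g'. split; [assumption|]. split; [assumption|].
    split; [|assumption].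
    exact (swap_mono _ _ _ _ _ _ _ _ HN Hn Ig' (proj1 If) B M2 M1).
  - wex (fun_val _ _ _ _ _ (proj1 Ig') Hn) as a [Ha M2]. wx a. split; [assumption|].
    wx f'. split; [assumption|]. wx g'. split; [assumption|]. split; [assumption|].
    split; [|assumption]. exact (swap_hit _ _ _ _ _ _ _ Hn (proj1 Ig') B M2).
Qed.

Lemma match_unique w s a b a' b' : (w ⊩ State s) -> (w ⊩ Match s a b) -> (w ⊩ Match s a' b') ->
  w ⊩ (a ≐ a' → b ≐ b') ∧ (b ≐ b' → a ≐ a').
Proof.
  intros H H1 H2. wex H as k [_ H]. wex H as j [_ [Q (If & Ig & _)]].
  wex H1 as f [_ H1]. wex H1 as g [_ (P & M1 & M2)].
  wex H2 as f' [_ H2]. wex H2 as g' [_ (P' & M1' & M2')].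
  destruct (pair_inj _ _ _ _ _ _ P Q) as [E1 E2]. ws E1. ws E2.
  destruct (pair_inj _ _ _ _ _ _ P' Q) as [E1 E2]. ws E1. ws E2.
  split; wi E.
  - rew E in M1. exact (fun_uniq _ _ _ _ _ _ _ (proj1 If) M1 M1').
  - rew E in M2. exact (fun_uniq _ _ _ _ _ _ _ (proj1 Ig) M2 M2').
Qed.

Lemma match_chain w s a b : (w ⊩ State s) -> (w ⊩ Match s a b) -> w ⊩ a ∈ N ∧ b ∈ N ∧ C a b.
Proof.
  intros H H1. wex H as k [_ H]. wex H as j [_ [Q (If & Ig & H3 & _)]].
  wex H1 as f [_ H1]. wex H1 as g [_ (P & M1 & M2)].
  destruct (pair_inj _ _ _ _ _ _ P Q) as [E1 E2]. rew E1 in M1.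
  destruct (rel_dom _ _ _ _ _ _ (proj1 If) M1) as [Ha Hb]. split; [assumption|]. split; [assumption|].
  exact (imp_e (imp_e (imp_e (H3 a) Ha b) Hb) M1).
Qed.

Definition MatchAt S t n a b : prop := ∃[S] s, Rel t n s ∧ Match s a b.

Lemma back_and_forth w f g : (w ⊩ NatSet N) -> (w ⊩ FunSet F N N) -> (w ⊩ Zigzag C N) ->
  (w ⊩ Good C N f g) ->
  w ⊩ ∃ h, Bij h N N ∧ ∀[N] x y, Rel h x y → C x y.
Proof.
  intros HN HF HZ G.
  wex (pair_ex w f g) as s0 P0. 
  wex (prod_ex w F F) as FF HFF.
  (* Recursion needs a set of states as codomain; it is cut out of a superset of F × F. *)
  wex (sep State w FF Bd_State) as S HS.
  assert (HS1 : w ⊩ ∀ s, State s → s ∈ S).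
  { wi s Hs. refine (imp_e (proj2 (HS s)) _). split; [|assumption].
    wex Hs as f' [Hf' H]. wex H as g' [Hg' [P _]]. wa HFF; [exact Hf'|..]; eassumption. }
  assert (HS2 : w ⊩ ∀[S] s, State s).
  { wi s Hs. exact (proj2 (imp_e (proj1 (HS s)) Hs)). }
  assert (Hs0 : w ⊩ s0 ∈ S).
  { refine (imp_e (HS1 s0) _). pose proof G as (If & Ig & _).
    wx f. split; [exact (imp_e (proj2 (HF f)) (proj1 If))|].
    wx g. split; [exact (imp_e (proj2 (HF g)) (proj1 Ig))|]. now split. }
  pose proof Bd_Step as BS. pose proof Bd_Match as BM.
  assert (HT : w ⊩ Functional Step N S).
  { wi n Hn s Hs. wex (step_ex _ _ _ HN HF HZ Hn (imp_e (HS2 s) Hs)) as s' [Hs' K].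
    wx s'. split; [exact (imp_e (HS1 s') Hs')|]. split; [assumption|].
    wi s'' _ K'. exact (step_unique _ _ _ _ _ K' K). }
  wex (recursion Step N S s0 BS w HN Hs0 HT) as t (Ht & _ & Hrec). clear HT Hs0 P0.
  assert (BMt : Bd3 (MatchAt S t)) by (unfold MatchAt; bd).
  assert (Hstep : w ⊩ ∀[N] n m, Succ m n → 
     (∀ a b, MatchAt S t n a b → MatchAt S t m a b) ∧ (∃[N] b, MatchAt S t m n b) ∧
     (∃[N] a, MatchAt S t m a n)).
  { wi n Hn m Hm Sm. wex (fun_val _ _ _ _ _ Ht Hn) as s [Hs Ts].
    wex (fun_val _ _ _ _ _ Ht Hm) as s' [Hs' Ts'].
    pose proof (imp_e (imp_e (imp_e (imp_e (imp_e (imp_e (imp_e (Hrec n) Hn m) Hm) Sm s) Hs s') Hs') Ts) Ts') as K.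
    destruct (step_match _ _ _ _ HN Hn (imp_e (HS2 s) Hs) (imp_e (HS2 s') Hs') K) as (K1 & K2 & K3).
    split; [|split].
    - wi a b H. wex H as s1 [Hs1 [T1 M]]. pose proof (fun_uniq _ _ _ _ _ _ _ Ht T1 Ts) as E.
      rew E in M. wx s'. split; [assumption|]. split; [assumption|]. exact (imp_e (K1 a b) M).
    - wex K2 as b [Hb M]. wx b. split; [assumption|]. wx s'. split; [assumption|]. now split.
    - wex K3 as a [Ha M]. wx a. split; [assumption|]. wx s'. split; [assumption|]. now split. }
  assert (Hmono : w ⊩ ∀[N] m, ∀[m] n, ∀[N] a b, MatchAt S t n a b → MatchAt S t m a b).
  { refine (nat_ind (fun m => ∀[m] n, ∀[N] a b, MatchAt S t n a b → MatchAt S t m a b) _ w N HN _ _);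
      [bd|..].
    - wi z Hz E n Hn. apply bot_e. wa E. exact Hn.
    - wi n Hn m Hm Sm IH. wi i Hi a Ha b Hb M.
      refine (imp_e (proj1 (imp_e (imp_e (imp_e (Hstep n) Hn m) Hm) Sm) a b) _).
      wor (imp_e (proj2 (proj2 Sm) i) Hi) as E|E.
      + exact (imp_e (imp_e (imp_e (imp_e (IH i) E a) Ha b) Hb) M).
      + rew E in M. exact M. }
  assert (Hdom : w ⊩ ∀ n a b, MatchAt S t n a b → a ∈ N ∧ b ∈ N ∧ C a b).
  { wi n a b M. wex M as s [Hs [_ M]]. exact (match_chain _ _ _ _ (imp_e (HS2 s) Hs) M). }
  assert (Huniq : w ⊩ ∀ n a b a' b', MatchAt S t n a b → MatchAt S t n a' b' →
     (a ≐ a' → b ≐ b') ∧ (b ≐ b' → a ≐ a')).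
  { wi n a b a' b'. wi M M'. wex M as s [Hs [T M]]. wex M' as s' [Hs' [T' M']].
    pose proof (fun_uniq _ _ _ _ _ _ _ Ht T T') as E. rew E in M.
    exact (match_unique _ _ _ _ _ _ (imp_e (HS2 s') Hs') M M'). }
  (* Matches found at two stages are compared at the later one; membership is the order of the
     stages. *)
  assert (Hall : w ⊩ ∀[N] n m, ∀ a b a' b', MatchAt S t n a b → MatchAt S t m a' b' →
     (a ≐ a' → b ≐ b') ∧ (b ≐ b' → a ≐ a')).
  { wi n Hn m Hm a b a' b'. wi M M'.
    destruct (imp_e (Hdom n a b) M) as (Ha & Hb & _).
    destruct (imp_e (Hdom m a' b') M') as (Ha' & Hb' & _).
    wor (imp_e (imp_e (trichotomy _ _ HN n) Hn m) Hm) as E|E; [|wor E as E|E].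
    - pose proof (imp_e (imp_e (imp_e (imp_e (imp_e (Hmono m) Hm n) E a) Ha b) Hb) M) as K.
      exact (imp_e (imp_e (Huniq m a b a' b') K) M').
    - rew E in M. exact (imp_e (imp_e (Huniq m a b a' b') M) M').
    - pose proof (imp_e (imp_e (imp_e (imp_e (imp_e (Hmono n) Hn m) E a') Ha' b') Hb') M') as K.
      exact (imp_e (imp_e (Huniq n a b a' b') M) K). }
  assert (Hfun : w ⊩ ∀[N] x, ∃[N] y, (∃[N] n, MatchAt S t n x y) ∧
      ∀[N] y', (∃[N] n, MatchAt S t n x y') → y' ≐ y).
  (* The step from stage x to stage x + 1 treats x, so x is certain to be matched at stage x + 1. *)
  { wi x Hx. wex (succ_ex _ _ _ HN Hx) as m [Hm Sm].
    wex (proj1 (proj2 (imp_e (imp_e (imp_e (Hstep x) Hx m) Hm) Sm))) as y [Hy M].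
    wx y. split; [assumption|]. split; [wx m; now split|].
    wi y' Hy' H. wex H as n [Hn M'].
    refine (imp_e (proj1 (imp_e (imp_e (imp_e (imp_e (Hall n) Hn m) Hm x y' x y) M') M)) _).
    apply peq_refl. }
  wex (fun_ex (fun x y => ∃[N] n, MatchAt S t n x y) ltac:(bd) w N N Hfun) as h [Hh1 Hh2].
  wx h. split; [split; [split; [assumption|]|]|].
  - wi x Hx x' Hx' y Hy H1. wi H2.
    wex (imp_e (proj1 (imp_e (imp_e (Hh2 x) Hx y) Hy)) H1) as n [Hn M].
    wex (imp_e (proj1 (imp_e (imp_e (Hh2 x') Hx' y) Hy)) H2) as m [Hm M'].
    refine (imp_e (proj2 (imp_e (imp_e (imp_e (imp_e (Hall n) Hn m) Hm x y x' y) M) M')) _).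
    apply peq_refl.
  - wi y Hy. wex (succ_ex _ _ _ HN Hy) as m [Hm Sm].
    wex (proj2 (proj2 (imp_e (imp_e (imp_e (Hstep y) Hy m) Hm) Sm))) as x [Hx M].
    wx x. split; [assumption|]. refine (imp_e (proj2 (imp_e (imp_e (Hh2 x) Hx y) Hy)) _).
    wx m. now split.
  - wi x Hx y Hy H. wex (imp_e (proj1 (imp_e (imp_e (Hh2 x) Hx y) Hy)) H) as n [Hn M].
    exact (proj2 (proj2 (imp_e (Hdom n x y) M))).
Qed.

End BackAndForth.

Lemma strong_myhill_nat w N : (w ⊩ NatSet N) -> w ⊩ StrongMyhill N N.
Proof.
  intros HN. wi f g Hf Hg. wex (chain_ex _ _ _ _ _ HN Hf Hg) as PX K.
  wex K as k (C1 & C2 & C3 & C4). wex (fun_set_ex w N N) as F HF.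
  refine (ex_e _ _ _ (back_and_forth N F (Chain N PX k g) (Bd_Chain _ _ _ _) w f g HN HF C3 _) _).
  - split; [assumption|]. split; [assumption|]. split; [assumption|].
    wi y Hy x Hx H. exact (imp_e (imp_e (imp_e (C2 x) Hx y) Hy) H).
  - intros h w' l [H1 H2]; lift l. wx h. split; [assumption|].
    wi x Hx y Hy H. exact (imp_e (imp_e (imp_e (C4 x) Hx y) Hy)
                             (imp_e (imp_e (imp_e (H2 x) Hx y) Hy) H)).
Qed.

(** * Truth values and their sequences *)

Section Omega.

Variables (e one O : nat).

Definition OmegaSpec : prop := (∀ x, x ∈ one ↔ x ≐ e) ∧ (∀ u, u ∈ O ↔ Sub u one).

Lemma omega_ext w u v : (w ⊩ OmegaSpec) -> (w ⊩ u ∈ O) -> (w ⊩ v ∈ O) ->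
  (w ⊩ e ∈ u ↔ e ∈ v) -> w ⊩ u ≐ v.
Proof.
  intros [H1 HO] Hu Hv [K1 K2]. apply ext. wi x. split; wi Hx.
  - pose proof (imp_e (proj1 (H1 x)) (imp_e (imp_e (proj1 (HO u)) Hu x) Hx)) as E.
    rew E in Hx. rew E. wa K1. exact Hx.
  - pose proof (imp_e (proj1 (H1 x)) (imp_e (imp_e (proj1 (HO v)) Hv x) Hx)) as E.
    rew E in Hx. rew E. wa K2. exact Hx.
Qed.

Lemma one_true w : (w ⊩ OmegaSpec) -> w ⊩ one ∈ O ∧ e ∈ one.
Proof.
  intros [H1 HO]. split.
  - refine (imp_e (proj2 (HO one)) _). wi x Hx. exact Hx.
  - refine (imp_e (proj2 (H1 e)) _). apply peq_refl.
Qed.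

Lemma true_one w u : (w ⊩ OmegaSpec) -> (w ⊩ u ∈ O) -> (w ⊩ e ∈ u) -> w ⊩ u ≐ one.
Proof.
  intros H Hu He. destruct (one_true w H) as [H1 H2]. apply omega_ext; [assumption..|].
  split; wi _; assumption.
Qed.

(** [one] is the only true element, so an injective j lets u be recovered as the truth value of j u
    = j 1. *)
Lemma omega_inj_spec w j u v q : (w ⊩ OmegaSpec) -> (w ⊩ Inj j O O) ->
  (w ⊩ Rel j u v) -> (w ⊩ Rel j one q) -> w ⊩ e ∈ u ↔ v ≐ q.
Proof.
  intros H Hj Hu Hq. destruct (rel_dom _ _ _ _ _ _ (proj1 Hj) Hu) as [Hu' _].
  destruct (one_true w H) as [H1 H2]. split.
  - wi He. pose proof (true_one _ _ H Hu' He) as E. rew E in Hu.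
    exact (fun_uniq _ _ _ _ _ _ _ (proj1 Hj) Hu Hq).
  - wi E. rew E in Hu. pose proof (inj_uniq _ _ _ _ _ _ _ Hj Hu Hq) as F. rew F. exact H2.
Qed.

(* With q = j 1, every u is the truth value of j u = q; hence j (j 1) = 1, and j is an involution. *)
Lemma omega_inj_surj w j : (w ⊩ OmegaSpec) -> (w ⊩ Inj j O O) -> w ⊩ ∀[O] y, ∃[O] x, Rel j x y.
Proof.
  intros H Hj. destruct (one_true w H) as [H1 H1'].
  wex (fun_val _ _ _ _ _ (proj1 Hj) H1) as q [Hq J1].
  wex (fun_val _ _ _ _ _ (proj1 Hj) Hq) as a [Ha J2].
  wex (fun_val _ _ _ _ _ (proj1 Hj) Ha) as b [Hb J3].
  destruct (omega_inj_spec _ _ _ _ _ H Hj J2 J1) as [Q1 Q2].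
  destruct (omega_inj_spec _ _ _ _ _ H Hj J3 J1) as [A1 A2].
  assert (Qa : w ⊩ e ∈ q → e ∈ a).
  { wi K. pose proof (imp_e Q1 K) as E. rew E. exact K. }
  (* This is j (j 1) = 1, and it suffices that b = j a equals q. If b is true, then a implies q
     because a gives b = q; with [Qa] this yields a = q, so q is true. If q is true, then so is a,
     and b = q again. *)
  assert (K : w ⊩ e ∈ a).
  { wa A2. apply omega_ext; [assumption..|]. split.
    - wi K. wa Q2. apply omega_ext; [assumption..|]. split; [|assumption].
      wi L. pose proof (imp_e A1 L) as E. rew E in K. exact K.
    - wi K. pose proof (imp_e A1 (imp_e Qa K)) as E. rew E. exact K. }
  pose proof (true_one _ _ H Ha K) as E1. rew E1 in J2.
  wi v Hv. wex (fun_val _ _ _ _ _ (proj1 Hj) Hv) as u [Hu V1].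
  wex (fun_val _ _ _ _ _ (proj1 Hj) Hu) as v' [Hv' V2].
  (* Since j q = 1, injectivity makes j (j v) true exactly when j v = q, that is, when v is true. *)
  assert (E : w ⊩ v' ≐ v).
  { destruct (omega_inj_spec _ _ _ _ _ H Hj V1 J1) as [B1 B2].
    apply omega_ext; [assumption..|]. split.
    - wi L. pose proof (true_one _ _ H Hv' L) as F. rew F in V2.
      wa B2. exact (inj_uniq _ _ _ _ _ _ _ Hj V2 J2).
    - wi L. pose proof (imp_e B1 L) as F. rew F in V2.
      pose proof (fun_uniq _ _ _ _ _ _ _ (proj1 Hj) V2 J2) as G. rew G. exact H1'. }
  rew E in V2. wx u. now split.
Qed.

Lemma strong_myhill_omega w N : (w ⊩ NatSet N) -> (w ⊩ OmegaSpec) -> w ⊩ StrongMyhill N O.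
Proof.
  intros HN H. apply strong_myhill_surj; [assumption|]. wi f Hf.
  apply omega_inj_surj; assumption.
Qed.

(** * Sequences of truth values *)

Definition Holds S n : prop := ∃[O] v, Rel S n v ∧ e ∈ v.

Lemma Bd_Holds : Bd2 Holds.
Proof. unfold Holds. bd. Qed.

Variables (N E : nat).

Lemma holds_ext w S T : (w ⊩ OmegaSpec) -> (w ⊩ Fun S N O) -> (w ⊩ Fun T N O) ->
  (w ⊩ ∀[N] n, Holds S n ↔ Holds T n) -> w ⊩ S ≐ T.
Proof.
  assert (L1 : forall w S n v, (w ⊩ Fun S N O) -> (w ⊩ Rel S n v) -> w ⊩ Holds S n ↔ e ∈ v).
  { clear. intros w S n v HS HR. split.
    - wi H. wex H as u [Hu [A1 A2]]. pose proof (fun_uniq _ _ _ _ _ _ _ HS A1 HR) as F.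
      rew F in A2. exact A2.
    - wi H. wx v. split; [exact (proj2 (rel_dom _ _ _ _ _ _ HS HR))|]. now split. }
  assert (L : forall w S T n v, (w ⊩ OmegaSpec) -> (w ⊩ Fun S N O) -> (w ⊩ Fun T N O) ->
    (w ⊩ Holds S n ↔ Holds T n) -> (w ⊩ Rel S n v) -> w ⊩ Rel T n v).
  { clear -L1. intros w S T n v H HS HT [H1 H2] HR.
    destruct (rel_dom _ _ _ _ _ _ HS HR) as [Hn Hv].
    wex (fun_val _ _ _ _ _ HT Hn) as u [Hu HR'].
    destruct (L1 _ _ _ _ HS HR) as [A1 A2]. destruct (L1 _ _ _ _ HT HR') as [B1 B2].
    assert (F : w ⊩ u ≐ v).
    { apply omega_ext; [assumption..|]. split; wi K.
      - exact (imp_e A1 (imp_e H2 (imp_e B2 K))).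
      - exact (imp_e B1 (imp_e H1 (imp_e A2 K))). }
    rew F in HR'. exact HR'. }
  intros H HS HT K. apply (fun_ext _ _ _ N O); [assumption..|].
  wi n Hn v Hv. destruct (imp_e (K n) Hn) as [K1 K2]. split; wi HR.
  - exact (L w S T n v H HS HT (conj K1 K2) HR).
  - exact (L w T S n v H HT HS (conj K2 K1) HR).
Qed.

(** The value at n is the subset of [one] cut out by the condition [Q n]; extensionality of truth
    values makes it unique, so no choice is involved. *)
Lemma holds_ex (Q : nat -> prop) (HQ : Bd1 Q) w : (w ⊩ OmegaSpec) ->
  w ⊩ ∃ S, Fun S N O ∧ ∀[N] n, Holds S n ↔ Q n.
Proof.
  intros H. destruct (one_true w H) as [_ He].
  assert (F : w ⊩ ∀[N] n, ∃[O] v, (e ∈ v ↔ Q n) ∧ ∀[O] v', (e ∈ v' ↔ Q n) → v' ≐ v).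
  { wi n Hn. wex (sep (fun _ => Q n) w one ltac:(bd)) as v Hv.
    assert (K : w ⊩ e ∈ v ↔ Q n).
    { split; wi L.
      - exact (proj2 (imp_e (proj1 (Hv e)) L)).
      - exact (imp_e (proj2 (Hv e)) (conj He L)). }
    assert (Ov : w ⊩ v ∈ O).
    { refine (imp_e (proj2 (proj2 H v)) _). wi x Hx. exact (proj1 (imp_e (proj1 (Hv x)) Hx)). }
    wx v. split; [assumption|]. split; [assumption|].
    wi v' Hv' [K1 K2]. apply omega_ext; [assumption..|]. split; wi L.
    - exact (imp_e (proj2 K) (imp_e K1 L)).
    - exact (imp_e K2 (imp_e (proj1 K) L)). }
  wex (fun_ex (fun n v => e ∈ v ↔ Q n) ltac:(bd) w N O F) as S [HS HR].
  wx S. split; [assumption|]. wi n Hn. split.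
  - wi K. wex K as v [Hv [K1 K2]].
    exact (imp_e (proj1 (imp_e (proj1 (imp_e (imp_e (HR n) Hn v) Hv)) K1)) K2).
  - wi K. wex (fun_val _ _ _ _ _ HS Hn) as v [Hv K1]. wx v. split; [assumption|].
    split; [assumption|]. exact (imp_e (proj2 (imp_e (proj1 (imp_e (imp_e (HR n) Hn v) Hv)) K1)) K).
Qed.

Lemma nat_cases w z : (w ⊩ NatSet N) -> (w ⊩ Empty z) -> w ⊩ ∀[N] n, n ≐ z ∨ ∃[N] m, Succ n m.
Proof.
  intros HN Ez. refine (nat_ind (fun n => n ≐ z ∨ ∃[N] m, Succ n m) _ w N HN _ _); [bd|..].
  - wi y Hy Ey. apply or_l. now apply empty_uniq.
  - wi n Hn m Hm S _. apply or_r. wx n. now split.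
Qed.

(* T = (P S, S 0, S 1, ...) *)
Definition Cons z (P : nat -> prop) S T : prop :=
  (Holds T z ↔ P S) ∧ ∀[N] n m, Succ m n → (Holds T m ↔ Holds S n).

Lemma cons_ex (P : nat -> prop) (HP : Bd1 P) w z : (w ⊩ NatSet N) -> (w ⊩ OmegaSpec) ->
  (w ⊩ FunSet E O N) -> (w ⊩ z ∈ N) -> (w ⊩ Empty z) ->
  w ⊩ ∃ f, Inj f E E ∧ ∀[E] S T, Rel f S T → Cons z P S T.
Proof.
  intros HN H HE Hz Ez. pose proof Bd_Holds as BH.
  assert (F : w ⊩ ∀[E] S, ∃[E] T, Cons z P S T ∧ ∀[E] T', Cons z P S T' → T' ≐ T).
  { wi S HS.
    wex (holds_ex (fun k => k ≐ z ∧ P S ∨ ∃[N] n, Succ k n ∧ Holds S n) ltac:(bd) w H) as T [HT K].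
    assert (CT : w ⊩ Cons z P S T).
    { split; [split|].
      - wi L. wor (imp_e (proj1 (imp_e (K z) Hz)) L) as [_ A]|A; [exact A|].
        wex A as n [_ [A _]]. eapply succ_nonempty; eassumption.
      - wi L. refine (imp_e (proj2 (imp_e (K z) Hz)) _). apply or_l. split; [apply peq_refl|assumption].
      - wi n Hn m Hm Sm. split; wi L.
        + wor (imp_e (proj1 (imp_e (K m) Hm)) L) as [A _]|A.
          * rew A in Sm. eapply succ_nonempty; eassumption.
          * wex A as n' [Hn' [A1 A2]]. pose proof (succ_inj _ _ _ _ _ HN Hn' Hn A1 Sm) as B.
            rew B in A2. exact A2.
        + refine (imp_e (proj2 (imp_e (K m) Hm)) _). apply or_r. wx n. split; [assumption|].
          now split. }
    wx T. split; [exact (imp_e (proj2 (HE T)) HT)|]. split; [assumption|].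
    wi T' HT' [C1 C2]. destruct CT as [D1 D2].
    apply holds_ext; [assumption|exact (imp_e (proj1 (HE T')) HT')|assumption|].
    wi k Hk. wor (imp_e (nat_cases _ _ HN Ez k) Hk) as A|A.
    - rew A. split; wi L.
      + exact (imp_e (proj2 D1) (imp_e (proj1 C1) L)).
      + exact (imp_e (proj2 C1) (imp_e (proj1 D1) L)).
    - wex A as n [Hn Sn].
      pose proof (imp_e (imp_e (imp_e (C2 n) Hn k) Hk) Sn) as C.
      pose proof (imp_e (imp_e (imp_e (D2 n) Hn k) Hk) Sn) as D.
      split; wi L.
      + exact (imp_e (proj2 D) (imp_e (proj1 C) L)).
      + exact (imp_e (proj2 C) (imp_e (proj1 D) L)). }
  wex (fun_ex (Cons z P) ltac:(unfold Cons; bd) w E E F) as f [Hf1 Hf2].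
  wx f. split; [split; [assumption|]|].
  (* Injectivity: the tail of the image R is the argument, whatever [P] puts in front. *)
  - wi S HS T HT R HR A. wi B.
    pose proof (proj2 (imp_e (proj1 (imp_e (imp_e (Hf2 S) HS R) HR)) A)) as A2.
    pose proof (proj2 (imp_e (proj1 (imp_e (imp_e (Hf2 T) HT R) HR)) B)) as B2.
    apply holds_ext; [assumption|exact (imp_e (proj1 (HE S)) HS)|exact (imp_e (proj1 (HE T)) HT)|].
    wi n Hn. wex (succ_ex _ _ _ HN Hn) as m [Hm Sm].
    pose proof (imp_e (imp_e (imp_e (A2 n) Hn m) Hm) Sm) as C.
    pose proof (imp_e (imp_e (imp_e (B2 n) Hn m) Hm) Sm) as D.
    split; wi L.
    + exact (imp_e (proj1 D) (imp_e (proj2 C) L)).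
    + exact (imp_e (proj1 C) (imp_e (proj2 D) L)).
  - wi S HS T HT A. exact (imp_e (proj1 (imp_e (imp_e (Hf2 S) HS T) HT)) A).
Qed.

Lemma bijection_to_inhabited w z : (w ⊩ NatSet N) -> (w ⊩ OmegaSpec) ->
  (w ⊩ FunSet E O N) -> (w ⊩ z ∈ N) -> (w ⊩ Empty z) -> (w ⊩ Myhill E) ->
  w ⊩ ∃ h, Bij h E E ∧ ∃[E] s b, (∀[N] n, ¬ Holds s n) ∧ Rel h s b ∧ Holds b z.
Proof.
  intros HN H HE Hz Ez HM. pose proof Bd_Holds as BH.
  wex (succ_ex _ _ _ HN Hz) as i [Hi Si].
  (* f puts S 0 → S 1 in front, so that f S ∈ B exactly when S ∈ A; g puts the true proposition
     [z ≐ z] in front. *)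
  wex (cons_ex (fun S => Holds S z → Holds S i) ltac:(bd) w z HN H HE Hz Ez) as f [If Cf].
  wex (cons_ex (fun S => z ≐ z) ltac:(bd) w z HN H HE Hz Ez) as g [Ig Cg].
  wex (sep (fun S => Holds S z → Holds S i) w E ltac:(bd)) as A HA.
  wex (sep (fun S => Holds S z) w E ltac:(bd)) as B HB.
  assert (PA : w ⊩ Preimage A f B E).
  { wi S. split.
    - wi HS. destruct (imp_e (proj1 (HA S)) HS) as [HS1 HS2]. split; [assumption|].
      wex (fun_val _ _ _ _ _ (proj1 If) HS1) as T [HT R]. wx T. split; [|assumption].
      refine (imp_e (proj2 (HB T)) (conj HT _)).
      exact (imp_e (proj2 (proj1 (imp_e (imp_e (imp_e (Cf S) HS1 T) HT) R))) HS2).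
    - wi [HS1 K]. wex K as T [HT R]. destruct (imp_e (proj1 (HB T)) HT) as [HT1 HT2].
      refine (imp_e (proj2 (HA S)) (conj HS1 _)).
      exact (imp_e (proj1 (proj1 (imp_e (imp_e (imp_e (Cf S) HS1 T) HT1) R))) HT2). }
  (* Since g S begins with true and continues with S 0, the implication defining [A] amounts at g S
     to S 0. *)
  assert (PB : w ⊩ Preimage B g A E).
  { wi S. split.
    - wi HS. destruct (imp_e (proj1 (HB S)) HS) as [HS1 HS2]. split; [assumption|].
      wex (fun_val _ _ _ _ _ (proj1 Ig) HS1) as T [HT R]. wx T. split; [|assumption].
      refine (imp_e (proj2 (HA T)) (conj HT _)). wi _.
      pose proof (proj2 (imp_e (imp_e (imp_e (Cg S) HS1 T) HT) R)) as C.
      exact (imp_e (proj2 (imp_e (imp_e (imp_e (C z) Hz i) Hi) Si)) HS2).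
    - wi [HS1 K]. wex K as T [HT R]. destruct (imp_e (proj1 (HA T)) HT) as [HT1 HT2].
      refine (imp_e (proj2 (HB S)) (conj HS1 _)).
      destruct (imp_e (imp_e (imp_e (Cg S) HS1 T) HT1) R) as [C1 C].
      refine (imp_e (proj1 (imp_e (imp_e (imp_e (C z) Hz i) Hi) Si)) (imp_e HT2 (imp_e (proj2 C1) _))).
      apply peq_refl. }
  assert (SA : w ⊩ Sub A E).
  { wi S HS. exact (proj1 (imp_e (proj1 (HA S)) HS)). }
  assert (SB : w ⊩ Sub B E).
  { wi S HS. exact (proj1 (imp_e (proj1 (HB S)) HS)). }
  wex (imp_e (imp_e (imp_e (imp_e (imp_e (imp_e (HM A B) SA) SB f g) If) Ig) PA) PB) as h [Bh K].
  wx h. split; [assumption|].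
  wex K as k [Sk Bk]. wex (holds_ex (fun _ => pbot) ltac:(bd) w H) as s [Fs Hs].
  pose proof (imp_e (proj2 (HE s)) Fs) as Es.
  (* The implication defining [A] holds vacuously for the everywhere false s, so the restriction of
     h sends s into [B]. *)
  assert (As : w ⊩ s ∈ A).
  { refine (imp_e (proj2 (HA s)) (conj Es _)). wi L. apply bot_e.
    exact (imp_e (proj1 (imp_e (Hs z) Hz)) L). }
  wex (fun_val _ _ _ _ _ (proj1 (proj1 Bk)) As) as b [Hb R].
  wx s. split; [assumption|]. destruct (imp_e (proj1 (HB b)) Hb) as [Eb Tb].
  wx b. split; [assumption|]. split; [|split; [|assumption]].
  - wi n Hn L. exact (imp_e (proj1 (imp_e (Hs n) Hn)) L).
  - wex R as p [Hp P]. wx p. split; [|assumption]. exact (imp_e (Sk p) Hp).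
Qed.

End Omega.

(** * Derivation of excluded middle *)

Lemma excluded_middle_of_myhill w :
  w ⊩ ∀ N, NatSet N →
      (∀ A B, StrongMyhill N A → StrongMyhill N B → ∀ E, FunSet E A B → Myhill E) →
      ExcludedMiddle.
Proof.
  wi N HN HM e He p Hp.
  wex (singleton_ex w e) as one H1. wex (powerset_ax w one) as O HO.
  pose proof (conj H1 HO : w ⊩ OmegaSpec e one O) as H.
  wex (fun_set_ex w O N) as E HE.
  pose proof (imp_e (imp_e (imp_e (HM O N) (strong_myhill_omega _ _ _ _ _ HN H))
                        (strong_myhill_nat _ _ HN) E) HE) as ME.
  wex (zero_ex _ _ HN) as z [Hz Ez]. pose proof (Bd_Holds e O) as BH.
  wex (bijection_to_inhabited e one O N E w z HN H HE Hz Ez ME) as h [Bh K].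
  wex K as s [Hs K]. wex K as b [Hb (Ns & R & T)].
  pose proof (imp_e (proj1 (HE s)) Hs) as Fs. pose proof (imp_e (proj1 (HE b)) Hb) as Fb.
  set (D := e ∈ p ∨ ¬ e ∈ p).
  assert (BD : Bd1 (fun _ => D)) by (unfold D; bd).
  assert (NND : w ⊩ ¬ ¬ D).
  { wi K. wa K. apply or_r. wi L. wa K. now apply or_l. }
  (* c is the pointwise conjunction of b with D; its preimage under h is t. *)
  wex (holds_ex e one O N (fun n => Holds e O b n ∧ D) ltac:(bd) w H) as c [Fc Hc].
  pose proof (imp_e (proj2 (HE c)) Fc) as Ec.
  wex (imp_e (proj2 Bh c) Ec) as t [Et Rt].
  pose proof (imp_e (proj1 (HE t)) Et) as Ft.
  assert (Ets : w ⊩ t ≐ s).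
  { apply (holds_ext e one O N); [assumption..|]. wi n Hn. split; wi L.
    (* The goal is a contradiction, so D may be assumed; then c = b, and injectivity of h gives t =
       s. *)
    - apply bot_e. wa NND. wi d.
      assert (Ecb : w ⊩ c ≐ b).
      { apply (holds_ext e one O N); [assumption..|]. wi m Hm. split; wi M.
        - exact (proj1 (imp_e (proj1 (imp_e (Hc m) Hm)) M)).
        - exact (imp_e (proj2 (imp_e (Hc m) Hm)) (conj M d)). }
      rew Ecb in Rt. pose proof (inj_uniq _ _ _ _ _ _ _ (proj1 Bh) Rt R) as F.
      rew F in L. exact (imp_e (imp_e (Ns n) Hn) L).
    - apply bot_e. exact (imp_e (imp_e (Ns n) Hn) L). }
  (* Now h sends s to both b and c, so b 0 yields c 0, which contains D. *)
  rew Ets in Rt. pose proof (fun_uniq _ _ _ _ _ _ _ (proj1 (proj1 Bh)) R Rt) as F.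
  rew F in T. exact (proj2 (imp_e (proj1 (imp_e (Hc z) Hz)) T)).
Qed.

(* Keeps conversion from unfolding the connectives when a formula is compared with its meaning. *)
Strategy 1000 [pall pand por pex pimp atom].

Theorem corollary25 :
  provable
    (∀ N, is_nat_set N →
      (∀ A B, strong_myhill N A → strong_myhill N B →
        ∀ E, is_function_set E A B → myhill E) →
      excluded_middle)%fm.
Proof. apply provable_sem. exact (excluded_middle_of_myhill nil). Qed.
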